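(* Let $N=2$, $Q=I_2$, and let $B$ be a real $2\times 2$ matrix with two different, real eigenvalues, both negative. Let $\mathcal L=\mathcal L^{Q,B}$ be the associated Ornstein--Uhlenbeck operator on $L^2(\gamma_\infty)$, where $\gamma_\infty$ is its invariant Gaussian probability measure. Then the generalized eigenspaces of $\mathcal L$ corresponding to distinct eigenvalues are mutually orthogonal in $L^2(\gamma_\infty)$ if and only if the two eigenspaces of $B$ are orthogonal in $\mathbb R^2$.
   Context: Let $Q$ be a real symmetric positive-definite $N\times N$ matrix and $B$ a real $N\times N$ matrix whose eigenvalues have negative real parts. For $t\in(0,+\infty]$ put $Q_t=\int_0^t e^{sB}Qe^{sB^*}\,ds$ (symmetric and positive definite) and let $\gamma_t$ be the Gaussian probability measure $d\gamma_t(x)=(2\pi)^{-N/2}(\det Q_t)^{-1/2}e^{-\frac12\langle Q_t^{-1}x,x\rangle}\,dx$ on $\mathbb R^N$. The Ornstein--Uhlenbeck semigroup is $\mathcal H_t f(x)=\int f(e^{tB}x-y)\,d\gamma_t(y)$, $t>0$, defined for bounded continuous $f$ and extended to $L^2(\gamma_\infty)$ (complex-valued functions); $\gamma_\infty$ is its unique invariant probability measure. The Ornstein--Uhlenbeck operator $\mathcal L=\mathcal L^{Q,B}$ is the infinitesimal generator of $(\mathcal H_t)_{t>0}$ on $L^2(\gamma_\infty)$; on Schwartz functions it is given by $\mathcal L f(x)=\frac12\operatorname{tr}(Q\nabla^2 f)(x)+\langle Bx,\nabla f(x)\rangle$, where $\nabla$ is the gradient and $\nabla^2$ the Hessian. A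 generalized eigenfunction of $\mathcal L$ with eigenvalue $\mu\in\mathbb C$ is a nonzero $u\in L^2(\gamma_\infty)$ (in the domain of the relevant power of $\mathcal L$) such that $(\mathcal L-\mu I)^k u=0$ for some positive integer $k$; the generalized eigenspace corresponding to $\mu$ is the span of these $u$. *)

(* Defs.v *)
From HB Require Import structures.
From mathcomp Require Export all_boot all_order all_algebra.
From mathcomp Require Export complex.
From mathcomp Require Export all_classical all_reals all_analysis.
From mathcomp Require Export measurable_realfun.
Export Order.TTheory GRing.Theory Num.Theory.
Export numFieldNormedType.Exports.

Set Implicit Arguments.
Unset Strict Implicit.
Unset Printing Implicit Defensive.

Local Open Scope classical_set_scope.
Local Open Scope ring_scope.
Local Open Scope complex_scope.

(** MathComp's [eigenspace A a] is the space of row vectors [v] such that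
    [v *m A = a *: v]; the eigenvectors of the map [x |-> A x] on column
    vectors are therefore the transposes of those of [A^T]. *)
Definition orthogonal_eigenspaces (R : realType) (n : nat) (A : 'M[R]_n)
    (a b : R) : Prop :=
  forall u v : 'rV[R]_n,
    (u <= eigenspace A^T a)%MS -> (v <= eigenspace A^T b)%MS ->
    u *m v^T = 0.

(** The plane is [R * R] with its product topology. The library attaches
    [lebesgue_measure] to [measurableTypeR R], an alias of [R], so measures on
    the plane are measures on the (convertible) product of two such aliases. *)
Section plane.
Context {R : realType}.
Implicit Types (A : 'M[R]_2) (x y : R * R).

Definition colv x : 'cV[R]_2 := \col_i (if i == 0 then x.1 else x.2).

Definition mxact A x : R * R := ((A *m colv x) 0 0, (A *m colv x) 1 0).

Definition dotp x y : R := x.1 * y.1 + x.2 * y.2.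

Definition expm A : 'M[R]_2 :=
  \matrix_(i, j) limn (series (fun k => (A ^+ k) i j / k`!%:R)).

Definition leb2 :
    {measure set (measurableTypeR R * measurableTypeR R) -> \bar R} :=
  (@lebesgue_measure R \x @lebesgue_measure R)%E.

End plane.

Section gaussian.
Context {R : realType}.
Variables (Q B : 'M[R]_2) (t : \bar R).

Definition Qmx : 'M[R]_2 :=
  \matrix_(i, j) \int[lebesgue_measure]_(s in [set s : R | 0 <= s /\ (s%:E <= t)%E])
    (expm (s *: B) *m Q *m expm (s *: B^T)) i j.

(** [(2 * pi)^-1] is [(2 pi)^(-N/2)] for [N = 2]. *)
Definition gauss_pdf (x : R * R) : R :=
  (2 * pi)^-1 * (Num.sqrt (\det Qmx))^-1 *
  expR (- (2^-1 * dotp (mxact (invmx Qmx) x) x)).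

Lemma gauss_pdf_ge0 x : 0 <= gauss_pdf x.
Proof.
by rewrite !mulr_ge0 ?expR_ge0 ?invr_ge0 ?sqrtr_ge0 ?mulr_ge0 ?pi_ge0.
Qed.

Lemma measurable_gauss_pdf : measurable_fun
    [set: measurableTypeR R * measurableTypeR R] gauss_pdf.
Proof.
have mlin (a b : R) :
    measurable_fun [set: measurableTypeR R * measurableTypeR R]
      (fun x : R * R => a * x.1 + b * x.2).
  by apply: measurable_funD; apply: measurable_funM.
rewrite /gauss_pdf; apply: measurable_funM => //.
apply: measurableT_comp => //; apply: measurableT_comp => //.
apply: measurable_funM => //; rewrite /dotp /mxact /=.
have -> : (fun x : R * R => (invmx Qmx *m colv x) 0 0 * x.1 +
             (invmx Qmx *m colv x) 1 0 * x.2) =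
    (fun x : R * R => (invmx Qmx 0 0 * x.1 + invmx Qmx 0 1 * x.2) * x.1 +
             (invmx Qmx 1 0 * x.1 + invmx Qmx 1 1 * x.2) * x.2).
  apply/funext => x; rewrite !mxE !big_ord_recl !big_ord0 !mxE /= !addr0.
  by congr (( _ * _ + invmx Qmx _ _ * _) * _ + (_ * _ + invmx Qmx _ _ * _) * _);
    apply/val_inj.
by apply: measurable_funD; apply: measurable_funM.
Qed.

Definition gamma : set (measurableTypeR R * measurableTypeR R) -> \bar R :=
  fun A => (\int[leb2]_(x in A) (gauss_pdf x)%:E)%E.

Let gamma0 : gamma set0 = 0%E.
Proof. by rewrite /gamma integral_set0. Qed.

Let gamma_ge0 A : (0 <= gamma A)%E.
Proof. by apply: integral_ge0 => x _; rewrite lee_fin gauss_pdf_ge0. Qed.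

Let gamma_sigma_additive : semi_sigma_additive gamma.
Proof.
move=> A mA tA mUA; rewrite /gamma ge0_integral_bigcup//=; last first.
- by move=> x _; rewrite lee_fin gauss_pdf_ge0.
- apply/measurable_EFinP; apply: measurable_funTS.
  exact: measurable_gauss_pdf.
apply: is_cvg_ereal_nneg_natsum_cond => n _ _; exact: gamma_ge0.
Qed.

HB.instance Definition _ := isMeasure.Build _ _ _
  gamma gamma0 gamma_ge0 gamma_sigma_additive.

End gaussian.

Section complex_L2.
Context d (T : measurableType d) (R : realType).
Variable mu : {measure set T -> \bar R}.
Implicit Types f g : T -> R[i].

Definition Cintegral f : R[i] :=
  Complex (\int[mu]_x complex.Re (f x)) (\int[mu]_x complex.Im (f x)).

Definition L2 f : Prop :=
  ((fun x => complex.Re (f x)) \in Lfun mu 2%:E) /\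
  ((fun x => complex.Im (f x)) \in Lfun mu 2%:E).

Definition L2norm f : \bar R := Lnorm mu 2%:E (fun x => (Normc.normc (f x))%:E).

Definition L2dot f g : R[i] := Cintegral (fun x => f x * (g x)^*).

(** Elements of [L^2] are represented by functions, so that equality in [L^2]
    is equality almost everywhere. *)
Definition L2eq f g : Prop := {ae mu, forall x, f x = g x}.

End complex_L2.

Section ornstein_uhlenbeck.
Context {R : realType}.
Variables Q B : 'M[R]_2.
Implicit Types f g u v : R * R -> R[i].

Local Notation gammaoo := (gamma Q B +oo%E).

Definition bounded_continuous f : Prop :=
  [/\ continuous (fun x => complex.Re (f x)), continuous (fun x => complex.Im (f x)) &
      exists M : R, forall x, Normc.normc (f x) <= M].

Definition ou_bc (t : R) f : R * R -> R[i] :=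
  fun x => Cintegral (gamma Q B t%:E)
    (fun y => f (mxact (expm (t *: B)) x - y)).

(** [ou t f g] : the continuous extension of [ou_bc t] from the bounded
    continuous functions to [L^2(gammaoo)] maps [f] to [g]. *)
Definition ou (t : R) f g : Prop :=
  [/\ L2 gammaoo f, L2 gammaoo g &
   exists F : nat -> R * R -> R[i],
     [/\ forall n, bounded_continuous (F n),
         L2norm gammaoo (fun x => F n x - f x) @[n --> \oo] --> 0%E &
         L2norm gammaoo (fun x => ou_bc t (F n) x - g x) @[n --> \oo] --> 0%E]].

(** [ou_gen f g] : [f] is in the domain of the generator of the semigroup,
    which maps it to [g]. *)
Definition ou_gen f g : Prop :=
  [/\ L2 gammaoo f, L2 gammaoo g &
   exists H : R -> R * R -> R[i],
     (forall t, 0 < t -> ou t f (H t)) /\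
     L2norm gammaoo (fun x => (t^-1)%:C * (H t x - f x) - g x)
       @[t --> 0^'+] --> 0%E].

(** [ou_pow mu k u v] : [u] is in the domain of the [k]-th power of the
    generator minus [mu], which maps it to [v]. *)
Fixpoint ou_pow (mu : R[i]) (k : nat) u v : Prop :=
  if k is k'.+1 then
    exists2 w, ou_gen u w & ou_pow mu k' (fun x => w x - mu * u x) v
  else L2eq gammaoo u v.

Definition gen_eigenfunction (mu : R[i]) u : Prop :=
  [/\ L2 gammaoo u, ~ L2eq gammaoo u (fun=> 0) &
      exists2 k : nat, (0 < k)%N & ou_pow mu k u (fun=> 0)].

Definition gen_eigenspace (mu : R[i]) u : Prop :=
  L2 gammaoo u /\
  exists (n : nat) (c : 'I_n -> R[i]) (e : 'I_n -> R * R -> R[i]),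
    (forall i, gen_eigenfunction mu (e i)) /\
    L2eq gammaoo u (fun x => \sum_(i < n) c i * e i x).

End ornstein_uhlenbeck.

(* Main.v *)
Require Import Defs.
From HB Require Import structures.
From mathcomp Require Import ring lra.

Set Implicit Arguments.
Unset Strict Implicit.
Unset Printing Implicit Defensive.
Local Open Scope classical_set_scope.
Local Open Scope ring_scope.
Local Open Scope complex_scope.

(** Let [l_i(x) = <a_i, x>] where [a_1], [a_2] are eigenvectors of the transpose
    of [B] for [b1], [b2]. In the plane the eigenvectors of [B] are those of its
    transpose turned by a right angle, so the eigenspaces of [B] are orthogonal
    exactly when [<a_1, a_2> = 0] ([orthogonal_eigenspacesP]).

    If the generalized eigenspaces of the generator are orthogonal, then so are
    [l_1] and [l_2], because [l_i] is an eigenfunction with eigenvalue [b_i]: the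
    Gaussian [gamma_t] is centred, hence [H_t l_i = e^(t b_i) l_i]
    ([ou_gen_lform]; as [l_i] is unbounded, [H_t l_i] is reached through
    truncations whose errors are controlled by the fourth moments of the
    Gaussians). The pairing of [l_1] and [l_2] is, up to a positive factor,
    [<Q_oo a_1, a_2>], which is the integral of
    [<e^(s B^T) a_1, e^(s B^T) a_2> = e^(s (b1 + b2)) <a_1, a_2>] over [s > 0],
    that is [- <a_1, a_2> / (b1 + b2)] ([L2dot_lform]). Hence [<a_1, a_2> = 0].

    Conversely, if [<a_1, a_2> = 0] then [B] is symmetric
    ([orthogonal_symmetric]). Then [B], [e^(tB)] and all covariance matrices are
    combinations of the same two orthogonal projections, and the density of the
    transition from [x] to [z], weighted by the invariant density at [x], is
    symmetric in [x] and [z] ([detailed_balance]). By Tonelli's theorem the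
    semigroup is symmetric on bounded continuous functions ([ouR_sym]); the
    symmetry passes to the [L2] extension of the semigroup and to its generator
    by continuity of the pairing ([L2dot_approx], [ou_sym], [ou_gen_sym]). A
    generalized eigenfunction of a symmetric operator is an eigenfunction with a
    real eigenvalue, and eigenfunctions for distinct eigenvalues are orthogonal
    ([symmetric_gen_eigenspaces_orthogonal]).

    The explicit computations rest on the spectral decomposition of [B], which
    turns [e^(sB)] and the covariance matrices into combinations of two rank-one
    projections ([expm_spectral], [Qmx_spectral]), and on the triangular square
    root of a covariance matrix, which turns integrals against a nondegenerate
    Gaussian into integrals against the standard one ([ge0_integral_gauss]). *)

(** * The complex L2 pairing *)

Section real_L2.
Context d (T : measurableType d) (R : realType).
Variable mu : {measure set T -> \bar R}.
Implicit Types f g h : T -> R.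

Definition ip f g : R := \int[mu]_x (f x * g x).

Lemma Lfun2_measurable f : f \in Lfun mu 2%:E -> measurable_fun setT f.
Proof. by move=> /sub_Lfun_mfun; rewrite inE. Qed.

Lemma Lfun2P f : measurable_fun setT f ->
  (\int[mu]_x (f x ^+ 2)%:E < +oo)%E -> f \in Lfun mu 2%:E.
Proof.
move=> mf fin; rewrite inE; apply/andP; split; rewrite inE//=.
rewrite /finite_norm unlock /Lnorm.
apply: poweR_lty; apply: le_lt_trans fin.
rewrite le_eqVlt; apply/orP; left; apply/eqP; apply: eq_integral => x _ /=.
by rewrite powR_mulrn// real_normK ?num_real.
Qed.

Lemma Lfun2_integrableM f g : f \in Lfun mu 2%:E -> g \in Lfun mu 2%:E ->
  mu.-integrable setT (EFin \o (fun x => f x * g x)).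
Proof. by move=> f2 g2; apply/Lfun1_integrable; exact: Lfun2_mul_Lfun1. Qed.

Lemma Lfun2D f g : f \in Lfun mu 2%:E -> g \in Lfun mu 2%:E ->
  (fun x => f x + g x) \in Lfun mu 2%:E.
Proof.
by move=> f2 g2; exact: ((@Lfun_addr_closed _ _ _ mu _ (lee1n 2)).2 f g f2 g2).
Qed.

Lemma Lfun2Z (a : R) f : f \in Lfun mu 2%:E -> (fun x => a * f x) \in Lfun mu 2%:E.
Proof.
move=> f2; have -> : (fun x => a * f x) = (a \o* f) by apply/funext => x /=; rewrite mulrC.
by apply: Lfun_scale => //; rewrite ler1n.
Qed.

Lemma ipC f g : ip f g = ip g f.
Proof. by apply: eq_Rintegral => x _; rewrite mulrC. Qed.

Lemma ipDl f g h : f \in Lfun mu 2%:E -> g \in Lfun mu 2%:E ->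
  h \in Lfun mu 2%:E -> ip (fun x => f x + g x) h = ip f h + ip g h.
Proof.
move=> f2 g2 h2; rewrite /ip -RintegralD//; [|exact: Lfun2_integrableM..].
by apply: eq_Rintegral => x _; rewrite mulrDl.
Qed.

Lemma ipZl (a : R) f h : f \in Lfun mu 2%:E -> h \in Lfun mu 2%:E ->
  ip (fun x => a * f x) h = a * ip f h.
Proof.
move=> f2 h2; rewrite /ip -RintegralZl//; last exact: Lfun2_integrableM.
by apply: eq_Rintegral => x _; rewrite mulrA.
Qed.

Lemma ipDr f g h : f \in Lfun mu 2%:E -> g \in Lfun mu 2%:E ->
  h \in Lfun mu 2%:E -> ip h (fun x => f x + g x) = ip h f + ip h g.
Proof. by move=> f2 g2 h2; rewrite ipC ipDl// !(ipC h). Qed.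

Lemma ipZr (a : R) f h : f \in Lfun mu 2%:E -> h \in Lfun mu 2%:E ->
  ip h (fun x => a * f x) = a * ip h f.
Proof. by move=> f2 h2; rewrite ipC ipZl// (ipC h). Qed.

Lemma ip_ge0 f : 0 <= ip f f.
Proof. by apply: Rintegral_ge0 => x _; rewrite -expr2 sqr_ge0. Qed.

(** Nonnegativity of the quadratic form [ip (a f + b g) (a f + b g)], at the
    coefficients that minimize it. *)
Lemma cauchy_schwarz_ip f g : f \in Lfun mu 2%:E -> g \in Lfun mu 2%:E ->
  `|ip f g| <= Num.sqrt (ip f f) * Num.sqrt (ip g g).
Proof.
move=> f2 g2; rewrite -sqrtrM ?ip_ge0// -sqrtr_sqr ler_wsqrtr//.
have H (a b : R) : 0 <= a ^+ 2 * ip f f + 2 * a * b * ip f g + b ^+ 2 * ip g g.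
  have F2 := Lfun2Z a f2; have G2 := Lfun2Z b g2.
  have := ip_ge0 (fun x => a * f x + b * g x).
  rewrite ipDl ?Lfun2D// !ipDr// !ipZl// !ipZr// (ipC g f).
  by congr (_ <= _); ring.
have := ip_ge0 f; rewrite le_eqVlt => /predU1P[f0|f0]; last first.
  by have := H (- ip f g) (ip f f); nra.
have := ip_ge0 g; rewrite le_eqVlt => /predU1P[g0|g0]; last first.
  by have := H (ip g g) (- ip f g); nra.
by have := H 1 1; have := H 1 (-1); rewrite -f0 -g0; nra.
Qed.

End real_L2.

Section complex_L2_theory.
Context d (T : measurableType d) (R : realType).
Variable mu : {measure set T -> \bar R}.
Implicit Types f g h : T -> R[i].
Local Notation re f := (fun x => complex.Re (f x)).
Local Notation im f := (fun x => complex.Im (f x)).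

(** The square of [L2norm], as a real number. *)
Definition sqn f : R := ip mu (re f) (re f) + ip mu (im f) (im f).

Lemma ReM (z w : R[i]) : complex.Re (z * w) =
  complex.Re z * complex.Re w - complex.Im z * complex.Im w.
Proof. by case: z w => [a b] [c e]. Qed.

Lemma ImM (z w : R[i]) : complex.Im (z * w) =
  complex.Re z * complex.Im w + complex.Im z * complex.Re w.
Proof. by case: z w => [a b] [c e]. Qed.

Lemma ReD (z w : R[i]) : complex.Re (z + w) = complex.Re z + complex.Re w.
Proof. by case: z w => [a b] [c e]. Qed.

Lemma ImD (z w : R[i]) : complex.Im (z + w) = complex.Im z + complex.Im w.
Proof. by case: z w => [a b] [c e]. Qed.

Lemma ReN (z : R[i]) : complex.Re (- z) = - complex.Re z.
Proof. by case: z => [a b]. Qed.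

Lemma ImN (z : R[i]) : complex.Im (- z) = - complex.Im z.
Proof. by case: z => [a b]. Qed.

Lemma ReJ (z : R[i]) : complex.Re (z^*)%C = complex.Re z.
Proof. by case: z => [a b]. Qed.

Lemma ImJ (z : R[i]) : complex.Im (z^*)%C = - complex.Im z.
Proof. by case: z => [a b]. Qed.

Lemma eq_complexP (z w : R[i]) : complex.Re z = complex.Re w ->
  complex.Im z = complex.Im w -> z = w.
Proof. by case: z w => [a b] [c e] /= -> ->. Qed.

Lemma L2dotE f g : L2 mu f -> L2 mu g -> L2dot mu f g =
  Complex (ip mu (re f) (re g) + ip mu (im f) (im g))
          (ip mu (im f) (re g) - ip mu (re f) (im g)).
Proof.
move=> [fr fi] [gr gi]; rewrite /L2dot /Cintegral; apply: eq_complexP => /=.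
  rewrite /ip -RintegralD//; [|exact: Lfun2_integrableM..].
  by apply: eq_Rintegral => x _; rewrite ReM ReJ ImJ mulrN opprK.
rewrite /ip -RintegralB//; [|exact: Lfun2_integrableM..].
by apply: eq_Rintegral => x _; rewrite ImM ReJ ImJ mulrN addrC.
Qed.

Lemma L2D f g : L2 mu f -> L2 mu g -> L2 mu (fun x => f x + g x).
Proof.
move=> [fr fi] [gr gi]; split.
  by under eq_fun do rewrite ReD; exact: Lfun2D.
by under eq_fun do rewrite ImD; exact: Lfun2D.
Qed.

Lemma L2Z (c : R[i]) f : L2 mu f -> L2 mu (fun x => c * f x).
Proof.
move=> [fr fi]; split.
  under eq_fun do rewrite ReM -mulNr; apply: Lfun2D; exact: Lfun2Z.
under eq_fun do rewrite ImM; apply: Lfun2D; exact: Lfun2Z.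
Qed.

Lemma L2N f : L2 mu f -> L2 mu (fun x => - f x).
Proof. by move=> /(@L2Z (-1)); under eq_fun do rewrite mulN1r. Qed.

Lemma L2B f g : L2 mu f -> L2 mu g -> L2 mu (fun x => f x - g x).
Proof. by move=> f2 /L2N g2; exact: L2D. Qed.

Lemma L2dotC f g : L2 mu f -> L2 mu g -> L2dot mu g f = ((L2dot mu f g)^*)%C.
Proof.
move=> f2 g2; rewrite !L2dotE//; apply: eq_complexP; rewrite ?ReJ ?ImJ /=.
  by rewrite (ipC mu (re g)) (ipC mu (im g)).
by rewrite opprB (ipC mu (re f)) (ipC mu (im f)).
Qed.

Lemma L2dotDl f g h : L2 mu f -> L2 mu g -> L2 mu h ->
  L2dot mu (fun x => f x + g x) h = L2dot mu f h + L2dot mu g h.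
Proof.
move=> f2 g2 h2; rewrite !L2dotE//; last exact: L2D.
case: f2 g2 h2 => [fr fi] [gr gi] [hr hi].
have -> : re (fun x => f x + g x) = (fun x => complex.Re (f x) + complex.Re (g x)).
  by apply/funext => x; rewrite ReD.
have -> : im (fun x => f x + g x) = (fun x => complex.Im (f x) + complex.Im (g x)).
  by apply/funext => x; rewrite ImD.
by rewrite !ipDl//; apply: eq_complexP; rewrite ?ReD ?ImD /=; ring.
Qed.

Lemma L2dotZl (c : R[i]) f h : L2 mu f -> L2 mu h ->
  L2dot mu (fun x => c * f x) h = c * L2dot mu f h.
Proof.
move=> f2 h2; rewrite !L2dotE//; last exact: L2Z.
case: f2 h2 => [fr fi] [hr hi].
have -> : re (fun x => c * f x) =
    (fun x => complex.Re c * complex.Re (f x) + (- complex.Im c) * complex.Im (f x)).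
  by apply/funext => x; rewrite ReM mulNr.
have -> : im (fun x => c * f x) =
    (fun x => complex.Re c * complex.Im (f x) + complex.Im c * complex.Re (f x)).
  by apply/funext => x; rewrite ImM.
rewrite !ipDl ?Lfun2Z// !ipZl//.
by apply: eq_complexP; rewrite ?ReM ?ImM /=; ring.
Qed.

Lemma L2dotZr (c : R[i]) f h : L2 mu f -> L2 mu h ->
  L2dot mu h (fun x => c * f x) = (c^*)%C * L2dot mu h f.
Proof.
move=> f2 h2; have cf2 := L2Z c f2.
by rewrite (L2dotC cf2 h2) (L2dotC f2 h2) L2dotZl// rmorphM.
Qed.

Lemma L2dotBl f g h : L2 mu f -> L2 mu g -> L2 mu h ->
  L2dot mu (fun x => f x - g x) h = L2dot mu f h - L2dot mu g h.
Proof.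
move=> f2 g2 h2; rewrite L2dotDl//; last exact: L2N.
congr (_ + _); have := L2dotZl (-1) g2 h2; rewrite mulN1r => <-.
by congr (L2dot _ _ _); apply/funext => x; rewrite mulN1r.
Qed.

Lemma L2dotBr f g h : L2 mu f -> L2 mu g -> L2 mu h ->
  L2dot mu h (fun x => f x - g x) = L2dot mu h f - L2dot mu h g.
Proof.
move=> f2 g2 h2; have fg2 := L2B f2 g2.
by rewrite (L2dotC fg2 h2) (L2dotC f2 h2) (L2dotC g2 h2) L2dotBl// rmorphB.
Qed.

Lemma sqn_ge0 f : 0 <= sqn f.
Proof. by rewrite addr_ge0 ?ip_ge0. Qed.

Lemma L2dotxx f : L2 mu f -> L2dot mu f f = (sqn f)%:C.
Proof.
by move=> f2; rewrite L2dotE//; congr Complex; rewrite ipC subrr.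
Qed.

(** The factor [2] comes from bounding each of the real and imaginary parts by a
    sum of two real pairings. *)
Lemma L2dot_bound f g : L2 mu f -> L2 mu g ->
  `|complex.Re (L2dot mu f g)| <= 2 * (Num.sqrt (sqn f) * Num.sqrt (sqn g)) /\
  `|complex.Im (L2dot mu f g)| <= 2 * (Num.sqrt (sqn f) * Num.sqrt (sqn g)).
Proof.
move=> f2 g2; rewrite L2dotE//=.
case: f2 g2 => [fr fi] [gr gi].
have le_re h : Num.sqrt (ip mu (re h) (re h)) <= Num.sqrt (sqn h).
  by rewrite ler_wsqrtr// lerDl ip_ge0.
have le_im h : Num.sqrt (ip mu (im h) (im h)) <= Num.sqrt (sqn h).
  by rewrite ler_wsqrtr// lerDr ip_ge0.
have H (u v : T -> R) : u \in Lfun mu 2%:E -> v \in Lfun mu 2%:E ->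
    Num.sqrt (ip mu u u) <= Num.sqrt (sqn f) ->
    Num.sqrt (ip mu v v) <= Num.sqrt (sqn g) ->
    `|ip mu u v| <= Num.sqrt (sqn f) * Num.sqrt (sqn g).
  move=> u2 v2 uf vg; apply: le_trans (cauchy_schwarz_ip u2 v2) _.
  by apply: ler_pM => //; exact: sqrtr_ge0.
rewrite mulr_natl mulr2n; split.
  by apply: le_trans (ler_normD _ _) _; apply: lerD; apply: H.
rewrite (ipC mu (im f)) (ipC mu (re f)).
apply: le_trans (ler_normB _ _) _; apply: lerD.
  by rewrite ipC; apply: H.
by rewrite ipC; apply: H.
Qed.

Lemma L2normE f : L2 mu f -> L2norm mu f = (Num.sqrt (sqn f))%:E.
Proof.
move=> [fr fi]; rewrite /L2norm unlock /Lnorm.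
have -> : (\int[mu]_x ((`|(Normc.normc (f x))%:E| `^ 2)))%E = (sqn f)%:E.
  transitivity (\int[mu]_x ((complex.Re (f x) * complex.Re (f x))%:E +
                            (complex.Im (f x) * complex.Im (f x))%:E))%E.
    apply: eq_integral => x _; rewrite /= powR_mulrn// real_normK ?num_real//.
    by case: (f x) => a b /=; rewrite sqr_sqrtr ?addr_ge0 ?sqr_ge0// !expr2.
  rewrite integralD//; [|exact: Lfun2_integrableM..].
  rewrite /sqn /ip /Rintegral EFinD !fineK//.
  - by apply: integrable_fin_num => //; exact: Lfun2_integrableM.
  - by apply: integrable_fin_num => //; exact: Lfun2_integrableM.
by rewrite poweR_EFin powR12_sqrt// sqn_ge0.
Qed.

Lemma L2eq_sqn0 f : L2 mu f -> sqn f = 0 -> L2eq mu f (fun=> 0).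
Proof.
move=> [fr fi] /eqP; rewrite paddr_eq0 ?ip_ge0// => /andP[/eqP r0 /eqP i0].
have H (u : T -> R) : u \in Lfun mu 2%:E -> ip mu u u = 0 ->
    {ae mu, forall x, u x = 0}.
  move=> u2 u0; have iu := Lfun2_integrableM u2 u2.
  have mu2 : measurable_fun setT (EFin \o (fun x => u x * u x)).
    by case/integrableP: iu.
  have : (\int[mu]_x `|(EFin \o (fun x => u x * u x)%R) x| = 0)%E.
    under eq_integral do rewrite /= ger0_norm -?expr2 ?sqr_ge0//.
    rewrite -[LHS]fineK; first by congr EFin; exact: u0.
    exact: integrable_fin_num.
  move=> /(ae_eq_integral_abs _ measurableT mu2); apply: filterS => x /(_ I) h.
  have {h}[] : (u x * u x)%:E = 0%E := h.
  by move/eqP; rewrite mulf_eq0 orbb => /eqP.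
move: (H _ fr r0) (H _ fi i0); apply: filterS2 => x.
by move=> a b; exact: eq_complexP.
Qed.


(** The pairing is jointly continuous for [L2norm], so an identity between
    pairings passes to limits. Stated with arbitrarily good approximations, it
    serves both sequences and one-sided limits in time. *)
Lemma L2dot_approx f b a g :
  L2 mu f -> L2 mu b -> L2 mu a -> L2 mu g ->
  (forall e : R, 0 < e -> exists f' b' a' g',
    [/\ [/\ L2 mu f', L2 mu b', L2 mu a' & L2 mu g'],
        (L2norm mu (fun x => f' x - f x)%R < e%:E)%E /\
        (L2norm mu (fun x => b' x - b x)%R < e%:E)%E,
        (L2norm mu (fun x => a' x - a x)%R < e%:E)%E /\
        (L2norm mu (fun x => g' x - g x)%R < e%:E)%E &
        L2dot mu f' b' = L2dot mu a' g']) ->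
  L2dot mu f b = L2dot mu a g.
Proof.
move=> f2 b2 a2 g2 H.
pose N h := Num.sqrt (sqn h).
have N0 h : 0 <= N h by exact: sqrtr_ge0.
(* [K * e] bounds the sum of the errors [2 * (N u + N v + 1) * e] of the two
   pairings *)
pose K := 4 * (N f + N b + N a + N g + 2).
have near_pair u v u' v' e : L2 mu u -> L2 mu v -> L2 mu u' -> L2 mu v' ->
    0 < e -> e <= 1 -> N (fun x => u' x - u x) < e -> N (fun x => v' x - v x) < e ->
    `|complex.Re (L2dot mu u' v') - complex.Re (L2dot mu u v)|
      <= 2 * (N u + N v + 1) * e /\
    `|complex.Im (L2dot mu u' v') - complex.Im (L2dot mu u v)|
      <= 2 * (N u + N v + 1) * e.
  move=> u2 v2 u'2 v'2 e0 e1 ue ve.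
  have du := L2B u'2 u2; have dv := L2B v'2 v2.
  have E : L2dot mu u' v' = L2dot mu u v +
      (L2dot mu (fun x => u' x - u x) v + L2dot mu u (fun x => v' x - v x) +
       L2dot mu (fun x => u' x - u x) (fun x => v' x - v x)).
    by rewrite !L2dotBl// !L2dotBr//; ring.
  have B h h' c : L2 mu h -> L2 mu h' -> N h * N h' <= c ->
      `|complex.Re (L2dot mu h h')| <= 2 * c /\
      `|complex.Im (L2dot mu h h')| <= 2 * c.
    move=> h2 h'2 hc; have [r i] := L2dot_bound h2 h'2.
    by split; [apply: le_trans r _|apply: le_trans i _]; rewrite ler_pM2l.
  have [r1 i1] := B _ _ (N v * e) du v2 ltac:(by rewrite mulrC ler_wpM2l// ltW).
  have [r2 i2] := B _ _ (N u * e) u2 dv ltac:(by rewrite ler_wpM2l// ltW).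
  have [r3 i3] := B _ _ e du dv ltac:(by have := N0 (fun x => u' x - u x); have := N0 (fun x => v' x - v x); nra).
  rewrite E !ReD !ImD !(addrC (_ (L2dot mu u v))) !addrK.
  split.
    apply: le_trans (ler_normD _ _) _.
    apply: le_trans (lerD (ler_normD _ _) (lexx _)) _; lra.
  apply: le_trans (ler_normD _ _) _.
  apply: le_trans (lerD (ler_normD _ _) (lexx _)) _; lra.
have zero (x : R) : (forall e, 0 < e -> e <= 1 -> `|x| <= K * e) -> x = 0.
  move=> xe; apply/eqP; rewrite -normr_eq0; apply/negPn/negP => x0.
  have {}x0 : 0 < `|x| by rewrite lt_def x0 /=.
  have K0 : 0 < K by rewrite /K mulr_gt0// ltr_wpDl ?addr_ge0.
  have e0 : 0 < Num.min 1 (`|x| / (2 * K)).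
    by rewrite lt_min ltr01 divr_gt0// mulr_gt0.
  have := xe _ e0; rewrite ge_min lexx => /(_ isT).
  apply/negP; rewrite -ltNge.
  apply: (@le_lt_trans _ _ (K * (`|x| / (2 * K)))).
    by rewrite ler_pM2l// ge_min lexx orbT.
  have -> : K * (`|x| / (2 * K)) = `|x| / 2 by field; rewrite gt_eqF.
  by rewrite ltr_pdivrMr// ltr_pMr// ltr1n.
have main e : 0 < e -> e <= 1 ->
    `|complex.Re (L2dot mu f b) - complex.Re (L2dot mu a g)| <= K * e /\
    `|complex.Im (L2dot mu f b) - complex.Im (L2dot mu a g)| <= K * e.
  move=> e0 e1; have [f' [b' [a' [g' [[f'2 b'2 a'2 g'2] [ff bb] [aa gg] E]]]]] := H e e0.
  move: ff bb aa gg; rewrite !L2normE ?lte_fin; [|exact: L2B..] => ff bb aa gg.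
  have [r1 i1] := near_pair _ _ _ _ _ f2 b2 f'2 b'2 e0 e1 ff bb.
  have [r2 i2] := near_pair _ _ _ _ _ a2 g2 a'2 g'2 e0 e1 aa gg.
  rewrite -E in r2 i2; rewrite distrC in r1; rewrite distrC in i1.
  split.
    apply: le_trans (ler_distD (complex.Re (L2dot mu f' b')) _ _) _.
    apply: le_trans (lerD r1 r2) _; rewrite /K.
    by have := N0 f; have := N0 b; have := N0 a; have := N0 g; nra.
  apply: le_trans (ler_distD (complex.Im (L2dot mu f' b')) _ _) _.
  apply: le_trans (lerD i1 i2) _; rewrite /K.
  by have := N0 f; have := N0 b; have := N0 a; have := N0 g; nra.
apply: eq_complexP; apply/eqP; rewrite -subr_eq0; apply/eqP; apply: zero => e e0 e1.
  by have [] := main e e0 e1.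
by have [] := main e e0 e1.
Qed.

End complex_L2_theory.

Section L2_ae.
Context d (T : measurableType d) (R : realType).
Variable mu : {measure set T -> \bar R}.
Implicit Types f g h : T -> R[i].

Lemma ip_ae0 (u v : T -> R) : u \in Lfun mu 2%:E -> v \in Lfun mu 2%:E ->
  {ae mu, forall x, u x = 0} -> ip mu u v = 0.
Proof.
move=> u2 v2 u0; rewrite /ip /Rintegral.
rewrite (_ : (\int[mu]_x (u x * v x)%:E = 0)%E)//.
have /integrableP[muv _] := Lfun2_integrableM u2 v2.
transitivity (\int[mu]_x (cst 0%E x) : \bar R)%E; last by rewrite integral0.
apply: ae_eq_integral => //.
by apply: filterS u0 => x /= -> _; rewrite mul0r.
Qed.

Lemma L2dot_ae0 f h : L2 mu f -> L2 mu h -> L2eq mu f (fun=> 0) -> L2dot mu f h = 0.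
Proof.
move=> f2 h2 f0; rewrite L2dotE//.
have r0 : {ae mu, forall x, complex.Re (f x) = 0} by apply: filterS f0 => x /= ->.
have i0 : {ae mu, forall x, complex.Im (f x) = 0} by apply: filterS f0 => x /= ->.
case: f2 h2 => [fr fi] [hr hi].
by rewrite !ip_ae0// addr0 subr0.
Qed.

Lemma L2eq_dotl f g h : L2 mu f -> L2 mu g -> L2 mu h -> L2eq mu f g ->
  L2dot mu f h = L2dot mu g h.
Proof.
move=> f2 g2 h2 fg; apply/eqP; rewrite -subr_eq0 -L2dotBl//; apply/eqP.
apply: L2dot_ae0 => //; first exact: L2B.
by apply: filterS fg => x /= ->; rewrite subrr.
Qed.

Lemma L2eq_dotr f g h : L2 mu f -> L2 mu g -> L2 mu h -> L2eq mu f g ->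
  L2dot mu h f = L2dot mu h g.
Proof. by move=> f2 g2 h2 fg; rewrite !(L2dotC _ h2)// (L2eq_dotl f2 g2 h2 fg). Qed.

Lemma L2dot_eq0 f : L2 mu f -> L2dot mu f f = 0 -> L2eq mu f (fun=> 0).
Proof. by move=> f2; rewrite L2dotxx// => -[]; exact: L2eq_sqn0. Qed.

Lemma L2_sum n (c : 'I_n -> R[i]) (e : 'I_n -> T -> R[i]) :
  (forall i, L2 mu (e i)) -> L2 mu (fun x => \sum_(i < n) c i * e i x).
Proof.
elim: n c e => [|n IH] c e e2.
  have -> : (fun x => \sum_(i < 0) c i * e i x) = (fun=> 0).
    by apply/funext => x; rewrite big_ord0.
  have z2 : (fun=> 0 : R) \in Lfun mu 2%:E.
    apply: Lfun2P => //; under eq_integral do rewrite expr0n /=.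
    by rewrite integral0 ltry.
  by split.
have -> : (fun x => \sum_(i < n.+1) c i * e i x) =
    (fun x => \sum_(i < n) c (widen_ord (leqnSn n) i) * e (widen_ord (leqnSn n) i) x
              + c ord_max * e ord_max x).
  by apply/funext => x; rewrite big_ord_recr.
by apply: L2D; [exact: IH|exact: L2Z].
Qed.

Lemma L2dot_suml n (c : 'I_n -> R[i]) (e : 'I_n -> T -> R[i]) h :
  (forall i, L2 mu (e i)) -> L2 mu h -> (forall i, L2dot mu (e i) h = 0) ->
  L2dot mu (fun x => \sum_(i < n) c i * e i x) h = 0.
Proof.
elim: n c e => [|n IH] c e e2 h2 e0.
  have s2 := L2_sum c e2; apply: L2dot_ae0 => //.
  by apply: nearW => x; rewrite big_ord0.
have -> : (fun x => \sum_(i < n.+1) c i * e i x) =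
    (fun x => \sum_(i < n) c (widen_ord (leqnSn n) i) * e (widen_ord (leqnSn n) i) x
              + c ord_max * e ord_max x).
  by apply/funext => x; rewrite big_ord_recr.
rewrite L2dotDl//; [|exact: L2_sum|exact: L2Z].
by rewrite L2dotZl// e0 mulr0 addr0 IH.
Qed.

End L2_ae.

(** * Two-by-two matrices with two real eigenvalues, and the covariance matrices *)

Section two_by_two.
Variable R : realType.

Lemma mx2P m (A A' : 'M[R]_(2, m)) :
  (forall j, A 0 j = A' 0 j) -> (forall j, A 1 j = A' 1 j) -> A = A'.
Proof.
move=> h0 h1; apply/matrixP => i j.
have [->|->] : i = 0 \/ i = 1; last by [].
  by case: i => -[|[|//]] ?; [left|right]; apply/val_inj.
exact: h0.
Qed.

Lemma ord2P (P : 'I_2 -> Prop) : P 0 -> P 1 -> forall i, P i.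
Proof.
move=> h0 h1 i; have [->|->] : i = 0 \/ i = 1; [|by []..].
by case: i => -[|[|//]] ?; [left|right]; apply/val_inj.
Qed.

Lemma big_I2 (V : zmodType) (F : 'I_2 -> V) : \sum_(i < 2) F i = F 0 + F 1.
Proof.
rewrite big_ord_recl big_ord_recl big_ord0 addr0.
by congr (_ + F _); apply/val_inj.
Qed.

Lemma mul2E m n (A : 'M[R]_(m, 2)) (C : 'M[R]_(2, n)) i j :
  (A *m C) i j = A i 0 * C 0 j + A i 1 * C 1 j.
Proof. by rewrite mxE big_I2. Qed.

(** The projection onto the eigenline of [b] along that of [c], when these are the
    two eigenvalues of [B]. *)
Definition specproj (B : 'M[R]_2) (b c : R) : 'M[R]_2 := (b - c)^-1 *: (B - c%:M).

Lemma eigenvalue2_det (B : 'M[R]_2) (b : R) : eigenvalue B b ->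
  (B 0 0 - b) * (B 1 1 - b) = B 0 1 * B 1 0.
Proof.
case/eigenvalueP => v /rowP vB v0.
have := vB 0; have := vB 1; rewrite !mul2E !mxE => e1 e0.
have a0 : v 0 0 * (B 0 0 - b) = - (v 0 1 * B 1 0) by lra.
have a1 : v 0 1 * (B 1 1 - b) = - (v 0 0 * B 0 1) by lra.
have [p|p] := eqVneq (v 0 0) 0; last first.
  apply: (mulfI p); rewrite mulrA a0.
  transitivity (- B 1 0 * (v 0 1 * (B 1 1 - b))); first by ring.
  by rewrite a1; ring.
have q : v 0 1 != 0.
  apply: contra v0 => /eqP q; apply/eqP/rowP; apply: ord2P; rewrite mxE.
    exact: p.
  exact: q.
apply: (mulfI q).
transitivity ((B 0 0 - b) * (v 0 1 * (B 1 1 - b))); first by ring.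
rewrite a1; transitivity (- B 0 1 * (v 0 0 * (B 0 0 - b))); first by ring.
by rewrite a0; ring.
Qed.

Lemma eigenvalues2_trdet (B : 'M[R]_2) (b1 b2 : R) : b1 != b2 ->
  eigenvalue B b1 -> eigenvalue B b2 ->
  B 0 0 + B 1 1 = b1 + b2 /\ B 0 0 * B 1 1 - B 0 1 * B 1 0 = b1 * b2.
Proof.
move=> b12 /eigenvalue2_det e1 /eigenvalue2_det e2.
have tr : B 0 0 + B 1 1 = b1 + b2.
  have d : b1 - b2 != 0 by rewrite subr_eq0.
  by apply: (mulfI d); lra.
split => //; have b11 : B 1 1 = b1 + b2 - B 0 0 by lra.
by move: e1; rewrite b11; lra.
Qed.

End two_by_two.

(** Trace and determinant are assumed instead of the eigenvalues themselves: these
    hypotheses pass to the transpose of [B]. *)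
Section spectral.
Context {R : realType}.
Variables (B : 'M[R]_2) (b1 b2 : R).
Hypothesis b12 : b1 != b2.
Hypothesis trB : B 0 0 + B 1 1 = b1 + b2.
Hypothesis detB : B 0 0 * B 1 1 - B 0 1 * B 1 0 = b1 * b2.
Let p1 := specproj B b1 b2.
Let p2 := specproj B b2 b1.

Let d12 : b1 - b2 != 0. Proof. by rewrite subr_eq0. Qed.
Let d21 : b2 - b1 != 0. Proof. by rewrite subr_eq0 eq_sym. Qed.

Lemma cayley_hamilton2 : (B - b1%:M) *m (B - b2%:M) = 0.
Proof.
apply: mx2P; apply: ord2P; rewrite mul2E !mxE /= ?mulr1n ?mulr0n ?subr0.
all: have b11 : B 1 1 = b1 + b2 - B 0 0 by rewrite -trB; ring.
all: move: detB; rewrite b11.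
all: lra.
Qed.

Lemma cayley_hamilton2C : (B - b2%:M) *m (B - b1%:M) = 0.
Proof.
apply: mx2P; apply: ord2P; rewrite mul2E !mxE /= ?mulr1n ?mulr0n ?subr0.
all: have b11 : B 1 1 = b1 + b2 - B 0 0 by rewrite -trB; ring.
all: move: detB; rewrite b11.
all: lra.
Qed.

Lemma specprojD : p1 + p2 = 1%:M.
Proof.
by apply: mx2P; apply: ord2P; rewrite /p1 /p2 /specproj !mxE /= ?mulr1n ?mulr0n; field; rewrite ?d12 ?d21.
Qed.

Lemma mul_specproj : p1 *m p2 = 0.
Proof. by rewrite -scalemxAl -scalemxAr cayley_hamilton2C !scaler0. Qed.

Lemma mul_specprojC : p2 *m p1 = 0.
Proof. by rewrite -scalemxAl -scalemxAr cayley_hamilton2 !scaler0. Qed.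

Lemma specproj_idl : p1 *m p1 = p1.
Proof. by rewrite -[RHS]mulmx1 -specprojD mulmxDr mul_specproj addr0. Qed.

Lemma specproj_idr : p2 *m p2 = p2.
Proof. by rewrite -[RHS]mulmx1 -specprojD mulmxDr mul_specprojC add0r. Qed.

Lemma spectral_decomposition : B = b1 *: p1 + b2 *: p2.
Proof.
by apply: mx2P; apply: ord2P; rewrite /p1 /p2 /specproj !mxE /= ?mulr1n ?mulr0n; field; rewrite ?d12 ?d21.
Qed.

Lemma spectral_exp k : B ^+ k = b1 ^+ k *: p1 + b2 ^+ k *: p2.
Proof.
elim: k => [|k IH]; first by rewrite !expr0 !scale1r specprojD.
have Bp1 : B *m p1 = b1 *: p1.
  rewrite [in LHS]spectral_decomposition mulmxDl -(scalemxAl b1) -(scalemxAl b2).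
  by rewrite specproj_idl mul_specprojC scaler0 addr0.
have Bp2 : B *m p2 = b2 *: p2.
  rewrite [in LHS]spectral_decomposition mulmxDl -(scalemxAl b1) -(scalemxAl b2).
  by rewrite specproj_idr mul_specproj scaler0 add0r.
rewrite !exprS IH -[B * _]/(B *m _) mulmxDr -(scalemxAr (b1 ^+ k)) -(scalemxAr (b2 ^+ k)) Bp1 Bp2 !scalerA.
by rewrite !(mulrC (_ ^+ k)).
Qed.

Lemma expm_spectral (s : R) :
  expm (s *: B) = expR (s * b1) *: p1 + expR (s * b2) *: p2.
Proof.
apply/matrixP => i j; rewrite [LHS]mxE [RHS]mxE [X in _ = X + _]mxE [X in _ = _ + X]mxE.
have -> : series (fun k : nat => ((s *: B) ^+ k) i j / k`!%:R) =
    (fun n => series (exp_coeff (s * b1)) n * p1 i j +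
              series (exp_coeff (s * b2)) n * p2 i j).
  apply/funext => n; rewrite /series /= !mulr_suml -big_split /=.
  apply: eq_bigr => k _; rewrite exprZn spectral_exp /exp_coeff /=.
  rewrite [X in X / _]mxE [X in _ * X / _]mxE [X in _ * (X + _) / _]mxE [X in _ * (_ + X) / _]mxE.
  by rewrite !exprMn; ring.
apply/cvg_lim => //.
apply: cvgD; apply: cvgMr_tmp; exact: is_cvg_series_exp_coeff.
Qed.

End spectral.

Section exp_integrals.
Context {R : realType}.
Notation mu := (@lebesgue_measure R).

Definition exp_dom (t : \bar R) : set R := [set s : R | 0 <= s /\ (s%:E <= t)%E].
(** The coefficients of the covariance matrix in the spectral decomposition. *)
Definition exp_int (b : R) (t : \bar R) : R := \int[mu]_(s in exp_dom t) expR (s * b).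

Lemma exp_dom_fin t : exp_dom t%:E = `[0, t]%classic.
Proof. by apply/seteqP; split => s /=; rewrite in_itv/= ?lee_fin => /andP. Qed.

Lemma exp_domy : exp_dom +oo = `[0, +oo[%classic.
Proof.
by apply/seteqP; split => s /=; rewrite in_itv/= andbT; [case|split; rewrite ?leey].
Qed.

Lemma measurable_exp_dom t : measurable (exp_dom t : set (measurableTypeR R)).
Proof.
case: t => [t||]; rewrite ?exp_dom_fin ?exp_domy//.
by rewrite (_ : exp_dom -oo = set0)//; apply/seteqP; split => s //= [].
Qed.

(** The integrals of [e^(sb)] are read off the exponential distribution of rate
    [- b]. *)
Lemma expRM_exponential_pdf (b s : R) : b < 0 -> 0 <= s ->
  expR (s * b) = (- b)^-1 * exponential_pdf (- b) s.
Proof.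
move=> b0 s0; rewrite exponential_pdfE// mulrA mulVf ?oppr_eq0 ?lt_eqF// mul1r.
by rewrite opprK mulrC.
Qed.

Lemma integral_exp_dom (b : R) (t : \bar R) : b < 0 ->
  (\int[mu]_(s in exp_dom t) (expR (s * b))%:E =
   ((- b)^-1)%:E * \int[mu]_(s in exp_dom t) (exponential_pdf (- b) s)%:E)%E.
Proof.
move=> b0; rewrite -ge0_integralZl//=.
- apply: eq_integral => s; rewrite inE => -[s0 _].
  by rewrite (expRM_exponential_pdf b0 s0) EFinM.
- exact: measurable_exp_dom.
- apply/measurable_EFinP; apply: measurable_funTS; exact: measurable_exponential_pdf.
- by move=> s _; rewrite lee_fin exponential_pdf_ge0// oppr_ge0 ltW.
- by rewrite lee_fin invr_ge0 oppr_ge0 ltW.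
Qed.

Lemma integral_expRM_fin (b t : R) : b < 0 -> 0 < t ->
  (\int[mu]_(s in exp_dom t%:E) (expR (s * b))%:E = ((1 - expR (t * b)) / (- b))%:E)%E.
Proof.
move=> b0 t0; rewrite integral_exp_dom// exp_dom_fin.
have := exponential_prob_itv0c (- b) t0; rewrite /exponential_prob => ->//.
by rewrite opprK -EFinB -EFinM mulrC (mulrC b).
Qed.

Lemma integral_expRMy (b : R) : b < 0 ->
  (\int[mu]_(s in exp_dom +oo) (expR (s * b))%:E = ((- b)^-1)%:E)%E.
Proof.
move=> b0; rewrite integral_exp_dom// exp_domy.
have nb0 : 0 < - b by rewrite oppr_gt0.
rewrite integral_mkcond -[RHS]mule1 -(integral_exponential_pdf nb0).
congr (_ * _)%E; apply: eq_integral => s _; rewrite patchE; case: ifPn => // s0.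
by rewrite /exponential_pdf patchE (negbTE s0).
Qed.


Lemma integrable_expRM (b : R) (t : \bar R) : b < 0 -> (0 < t)%E ->
  mu.-integrable (exp_dom t) (EFin \o (fun s : R => expR (s * b))).
Proof.
move=> b0 t0; apply/integrableP; split.
  apply/measurable_EFinP; apply: measurable_funTS.
  by apply: measurableT_comp => //; exact: measurable_funM.
under eq_integral do rewrite /= ger0_norm ?expR_ge0//.
case: t t0 => [t||//]; rewrite ?lte_fin => t0.
  by rewrite integral_expRM_fin// ltry.
by rewrite integral_expRMy// ltry.
Qed.

Lemma exp_int_fin (b t : R) : b < 0 -> 0 < t ->
  exp_int b t%:E = (1 - expR (t * b)) / (- b).
Proof. by move=> b0 t0; rewrite /exp_int /Rintegral integral_expRM_fin. Qed.

Lemma exp_inty (b : R) : b < 0 -> exp_int b +oo = (- b)^-1.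
Proof. by move=> b0; rewrite /exp_int /Rintegral integral_expRMy. Qed.

Lemma exp_int_gt0 (b : R) (t : \bar R) : b < 0 -> (0 < t)%E -> 0 < exp_int b t.
Proof.
move=> b0; case: t => [t||//]; rewrite ?lte_fin => t0.
  by rewrite exp_int_fin// divr_gt0 ?oppr_gt0// subr_gt0 expR_lt1 nmulr_llt0.
by rewrite exp_inty// invr_gt0 oppr_gt0.
Qed.

Lemma Rintegral_exp3 (x y z a b c : R) (t : \bar R) :
  a < 0 -> b < 0 -> c < 0 -> (0 < t)%E ->
  \int[mu]_(s in exp_dom t) (x * expR (s * a) + y * expR (s * b) + z * expR (s * c)) =
  x * exp_int a t + y * exp_int b t + z * exp_int c t.
Proof.
move=> a0 b0 c0 t0; have mD := measurable_exp_dom t.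
have I (k d : R) : d < 0 ->
    mu.-integrable (exp_dom t) (EFin \o (fun s : R => k * expR (s * d))).
  by move=> d0; exact: (integrableZl mD k (integrable_expRM d0 t0)).
rewrite RintegralD//; [|exact: (integrableD mD (I x _ a0) (I y _ b0))|exact: I].
rewrite RintegralD//; [|exact: I..].
by rewrite !RintegralZl//; exact: integrable_expRM.
Qed.

(** The exponentials [x e^(sa) + y e^(sb)] have nonnegative squares, so the quadratic
    form with these coefficients is nonnegative. *)
Lemma exp_int_cauchy_schwarz (a b : R) (t : \bar R) : a < 0 -> b < 0 -> (0 < t)%E ->
  exp_int (a + b) t ^+ 2 <= exp_int (a + a) t * exp_int (b + b) t.
Proof.
move=> a0 b0 t0.
have [aa ab bb] : [/\ a + a < 0, a + b < 0 & b + b < 0] by split; lra.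
have H (x y : R) : 0 <= x ^+ 2 * exp_int (a + a) t +
    2 * x * y * exp_int (a + b) t + y ^+ 2 * exp_int (b + b) t.
  rewrite -Rintegral_exp3//; apply: Rintegral_ge0 => s _.
  rewrite !mulrDr !expRD.
  have -> : x ^+ 2 * (expR (s * a) * expR (s * a)) +
      2 * x * y * (expR (s * a) * expR (s * b)) +
      y ^+ 2 * (expR (s * b) * expR (s * b)) =
      (x * expR (s * a) + y * expR (s * b)) ^+ 2 by ring.
  exact: sqr_ge0.
have p := exp_int_gt0 aa t0.
have := H (- exp_int (a + b) t) (exp_int (a + a) t).
by nra.
Qed.

End exp_integrals.

(* Unification must not unfold the integrals. *)
#[local] Opaque exp_int.

Section covariance.
Context {R : realType}.
Variables (B : 'M[R]_2) (b1 b2 : R).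
Hypothesis b12 : b1 != b2.
Hypotheses (b1_lt0 : b1 < 0) (b2_lt0 : b2 < 0).
Hypothesis trB : B 0 0 + B 1 1 = b1 + b2.
Hypothesis detB : B 0 0 * B 1 1 - B 0 1 * B 1 0 = b1 * b2.
Variable t : \bar R.
Hypothesis t_gt0 : (0 < t)%E.
Notation p1 := (specproj B b1 b2).
Notation p2 := (specproj B b2 b1).
Notation c11 := (exp_int (b1 + b1) t).
Notation c12 := (exp_int (b1 + b2) t).
Notation c22 := (exp_int (b2 + b2) t).

Lemma specproj_tr b c : specproj B^T b c = (specproj B b c)^T.
Proof. by apply/matrixP => i j; rewrite !mxE eq_sym. Qed.

Lemma Qmx_spectral : Qmx 1%:M B t =
  c11 *: (p1 *m p1^T) + c12 *: (p1 *m p2^T + p2 *m p1^T) + c22 *: (p2 *m p2^T).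
Proof.
apply/matrixP => i j; rewrite [LHS]mxE.
rewrite [RHS]mxE [X in _ = X + _]mxE [X in _ = X + _ + _]mxE.
rewrite [X in _ = _ + X + _]mxE [X in _ = _ + _ + X]mxE.
rewrite !(mulrC (exp_int _ _)).
have [aa ab bb] : [/\ b1 + b1 < 0, b1 + b2 < 0 & b2 + b2 < 0].
  by move: b1_lt0 b2_lt0 => ? ?; split; lra.
rewrite -Rintegral_exp3//.
apply: eq_Rintegral => s _; rewrite mulmx1.
rewrite (expm_spectral b12 trB detB).
have -> : expm (s *: B^T) = expR (s * b1) *: p1^T + expR (s * b2) *: p2^T.
  rewrite -!specproj_tr; apply: expm_spectral; rewrite ?mxE//.
  by rewrite (mulrC (B 1 0)).
set q1 := p1; set q2 := p2.
rewrite mulmxDl !mulmxDr -!(scalemxAl _ q1) -!(scalemxAl _ q2) -!(scalemxAr _ _ q1^T).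
rewrite -!(scalemxAr _ _ q2^T) !scalerA -!expRD -!mulrDr.
move: (q1 *m q1^T) (q1 *m q2^T) (q2 *m q1^T) (q2 *m q2^T) => M1 M2 M3 M4.
by rewrite !mxE (addrC b2 b1); ring.
Qed.

Lemma Qmx_form (x : 'rV[R]_2) : (x *m Qmx 1%:M B t *m x^T) 0 0 =
  c11 * ((x *m p1) 0 0 ^+ 2 + (x *m p1) 0 1 ^+ 2) +
  2 * c12 * ((x *m p1) 0 0 * (x *m p2) 0 0 + (x *m p1) 0 1 * (x *m p2) 0 1) +
  c22 * ((x *m p2) 0 0 ^+ 2 + (x *m p2) 0 1 ^+ 2).
Proof.
have E (y z : 'rV[R]_2) : (y *m z^T) 0 0 = y 0 0 * z 0 0 + y 0 1 * z 0 1.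
  by rewrite mul2E !mxE.
have -> : x *m Qmx 1%:M B t *m x^T =
    c11 *: ((x *m p1) *m (x *m p1)^T) +
    c12 *: ((x *m p1) *m (x *m p2)^T + (x *m p2) *m (x *m p1)^T) +
    c22 *: ((x *m p2) *m (x *m p2)^T).
  rewrite Qmx_spectral !trmx_mul.
  move: p1 p2 => q1 q2.
  by rewrite !mulmxDr !mulmxDl -!scalemxAr -!scalemxAl !mulmxDr !mulmxDl !mulmxA.
move: (x *m p1) (x *m p2) => p q.
move: (p *m p^T) (p *m q^T) (q *m p^T) (q *m q^T) (E p p) (E p q) (E q p) (E q q).
by move=> M1 M2 M3 M4 E1 E2 E3 E4; rewrite !mxE E1 E2 E3 E4; ring.
Qed.

(** With [p], [q] the spectral components of [x], the form is
    [c11 |p|^2 + 2 c12 <p, q> + c22 |q|^2]. By Cauchy-Schwarz it can only vanish if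
    [c11 p + c12 q = 0], and applying the projections gives [p = q = 0]. *)
Lemma Qmx_pos (x : 'rV[R]_2) : x != 0 -> 0 < (x *m Qmx 1%:M B t *m x^T) 0 0.
Proof.
move=> x0; rewrite ltNge; apply: contra x0 => le0.
have [aa ab bb] : [/\ b1 + b1 < 0, b1 + b2 < 0 & b2 + b2 < 0].
  by move: b1_lt0 b2_lt0 => ? ?; split; lra.
have c11p := exp_int_gt0 aa t_gt0; have c12p := exp_int_gt0 ab t_gt0.
have cs := exp_int_cauchy_schwarz b1_lt0 b2_lt0 t_gt0.
have xE : x = x *m p1 + x *m p2 by rewrite -mulmxDr specprojD// mulmx1.
have pp1 : x *m p1 *m p1 = x *m p1 by rewrite -mulmxA specproj_idl.
have qp1 : x *m p2 *m p1 = 0 by rewrite -mulmxA mul_specprojC// mulmx0.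
move: le0; rewrite Qmx_form xE.
rewrite !mulmxDl pp1 qp1.
have -> : x *m p1 *m p2 = 0 by rewrite -mulmxA mul_specproj// mulmx0.
have -> : x *m p2 *m p2 = x *m p2 by rewrite -mulmxA specproj_idr.
move: pp1 qp1; rewrite addr0 add0r; move: (x *m p1) (x *m p2) => p q pp1 qp1 le0.
have [e0 e1] : c11 * p 0 0 + c12 * q 0 0 = 0 /\ c11 * p 0 1 + c12 * q 0 1 = 0.
  have : (c11 * p 0 0 + c12 * q 0 0) ^+ 2 + (c11 * p 0 1 + c12 * q 0 1) ^+ 2 <= 0.
    have h : 0 <= (c11 * c22 - c12 ^+ 2) * (q 0 0 ^+ 2 + q 0 1 ^+ 2).
      by rewrite mulr_ge0 ?subr_ge0// addr_ge0 ?sqr_ge0.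
    have := ler_wpM2l (ltW c11p) le0; rewrite mulr0; lra.
  move=> h; split; apply/eqP; rewrite -sqrf_eq0 eq_le sqr_ge0 andbT.
    by apply: le_trans h; rewrite lerDl sqr_ge0.
  by apply: le_trans h; rewrite lerDr sqr_ge0.
have e : c11 *: p + c12 *: q = 0.
  by apply/rowP; apply: ord2P; rewrite !mxE.
have p0 : p = 0.
  have := congr1 (fun z => z *m p1) e; rewrite /= mulmxDl -!scalemxAl pp1 qp1.
  by rewrite scaler0 addr0 mul0mx => /eqP; rewrite scaler_eq0 gt_eqF//= => /eqP.
move: e; rewrite p0 scaler0 !add0r => /eqP.
by rewrite scaler_eq0 gt_eqF.
Qed.

Lemma Qmx_sym : (Qmx 1%:M B t)^T = Qmx 1%:M B t.
Proof.
rewrite Qmx_spectral; move: p1 p2 => q1 q2.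
have e (M N : 'M[R]_2) i j : (M *m N^T) j i = (N *m M^T) i j.
  by rewrite -[in RHS](trmxK N) -trmx_mul [RHS]mxE.
apply/matrixP => i j; rewrite [LHS]mxE.
move: (e q1 q1 i j) (e q1 q2 i j) (e q2 q1 i j) (e q2 q2 i j).
move: (q1 *m q1^T) (q1 *m q2^T) (q2 *m q1^T) (q2 *m q2^T) => M1 M2 M3 M4 E1 E2 E3 E4.
by rewrite !mxE E1 E2 E3 E4 (addrC (M3 i j)).
Qed.

(** Positivity on [(1, 0)] and on [(- S01, S00)], where the form is
    [S00 * det S]. *)
Lemma Qmx_posdef : [/\ Qmx 1%:M B t 1 0 = Qmx 1%:M B t 0 1, 0 < Qmx 1%:M B t 0 0 &
  0 < Qmx 1%:M B t 0 0 * Qmx 1%:M B t 1 1 - Qmx 1%:M B t 0 1 ^+ 2].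
Proof.
have sym : Qmx 1%:M B t 1 0 = Qmx 1%:M B t 0 1 by rewrite -{1}Qmx_sym mxE.
have pos := Qmx_pos; move: (Qmx _ _ _) sym pos => S sym pos.
have row2 (a b : R) : (a != 0) || (b != 0) ->
    0 < a ^+ 2 * S 0 0 + 2 * a * b * S 0 1 + b ^+ 2 * S 1 1.
  move=> ab; pose x : 'rV[R]_2 := \row_j (if j == 0 then a else b).
  have x0 : x != 0.
    apply/negP => /eqP/rowP x0; move: (x0 0) (x0 1); rewrite !mxE /= => a0 b0.
    by move: ab; rewrite a0 b0 eqxx.
  have := pos x x0; rewrite !mul2E !mxE /= sym.
  by congr (_ < _); ring.
have a0 : 0 < S 0 0.
  by have := row2 1 0; rewrite oner_eq0 => /(_ isT); rewrite expr1n; lra.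
split=> //.
have := row2 (- S 0 1) (S 0 0); rewrite (gt_eqF a0) orbT => /(_ isT) h.
by rewrite -(pmulr_rgt0 _ a0); move: h; congr (_ < _); ring.
Qed.

End covariance.

(** * Densities, affine substitutions and measurability on the plane *)

Section density.
Local Open Scope ereal_scope.
Context d (T : measurableType d) (R : realType).
Variables (m nu : {measure set T -> \bar R}) (g : T -> R).
Hypothesis mg : measurable_fun setT g.
Hypothesis g0 : forall x, (0 <= g x)%R.
Hypothesis nuE : forall A, measurable A -> nu A = \int[m]_(x in A) (g x)%:E.

Import HBNNSimple.

Let meg : measurable_fun setT (EFin \o g). Proof. exact/measurable_EFinP. Qed.

Let density_indic A : measurable A ->
  \int[nu]_x (\1_A x)%:E = \int[m]_x ((\1_A x)%:E * (g x)%:E).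
Proof.
move=> mA; rewrite integral_indic// setIT nuE// integral_mkcond.
apply: eq_integral => x _; rewrite patchE indicE.
by case: (x \in A); rewrite ?mul1e ?mul0e.
Qed.

Let density_nnsfun (h : {nnsfun T >-> R}) :
  \int[nu]_x (h x)%:E = \int[m]_x ((h x)%:E * (g x)%:E).
Proof.
under [LHS]eq_integral do rewrite fimfunE -fsumEFin//.
rewrite [LHS]ge0_integral_fsum//; last 2 first.
  - by move=> r; exact/measurable_EFinP/measurableT_comp.
  - by move=> n x _; rewrite EFinM nnfun_muleindic_ge0.
under [RHS]eq_integral.
  move=> x xD; rewrite fimfunE -fsumEFin// ge0_mule_fsuml; last first.
    by move=> r; rewrite EFinM nnfun_muleindic_ge0.
  over.
rewrite [RHS]ge0_integral_fsum//; last 2 first.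
  - move=> r; apply: emeasurable_funM => //.
    by apply/measurable_EFinP; apply/measurableT_comp.
  - by move=> n x _; apply: mule_ge0; [rewrite EFinM nnfun_muleindic_ge0|rewrite lee_fin].
apply: eq_fsbigr => r _; rewrite integralZl_indic_nnsfun//.
have [r0|r0] := ltP r 0%R.
  rewrite preimage_nnfun0//; under [in LHS]eq_integral do rewrite indic0.
  rewrite integral0 mule0; under eq_integral do rewrite indic0 mulr0 mul0e.
  by rewrite integral0.
rewrite density_indic// -ge0_integralZl//.
- by apply: eq_integral => x _; rewrite EFinM muleA.
- by apply: emeasurable_funM => //; exact/measurable_EFinP.
- by move=> x _; rewrite mule_ge0// lee_fin.
Qed.

(** Monotone convergence carries the identity [nuE] from indicators to nonnegative
    functions. *)
Lemma ge0_integral_density (f : T -> \bar R) :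
  measurable_fun setT f -> (forall x, 0 <= f x) ->
  \int[nu]_x f x = \int[m]_x (f x * (g x)%:E).
Proof.
move=> mf f0; pose f_ := nnsfun_approx measurableT mf.
have cf x : (f_ n x)%:E @[n --> \oo] --> f x by exact: cvg_nnsfun_approx.
have nd x : {homo (fun n => (f_ n x)%:E) : a b / (a <= b)%N >-> a <= b}.
  by move=> a b ab; rewrite lee_fin; exact/lefP/nd_nnsfun_approx.
have mh n : measurable_fun setT (fun x => (f_ n x)%:E * (g x)%:E).
  by apply: emeasurable_funM => //; exact/measurable_EFinP.
transitivity (limn (fun n => \int[nu]_x (f_ n x)%:E)).
  rewrite -monotone_convergence//=.
  - by apply: eq_integral => x _; apply/esym/cvg_lim => //=; exact: cf.
  - by move=> n; exact/measurable_EFinP.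
  - by move=> n x _; rewrite lee_fin.
rewrite (_ : (fun n => _) = (fun n => \int[m]_x ((f_ n x)%:E * (g x)%:E))); last first.
  by apply/funext => n; rewrite density_nnsfun.
rewrite -monotone_convergence//=.
- apply: eq_integral => x _; apply/cvg_lim => //=.
  by apply: cvgeZr => //; exact: cf.
- by move=> n x _; rewrite mule_ge0// lee_fin.
- by move=> x _ a b ab; rewrite lee_wpmul2r ?lee_fin// -lee_fin; exact: nd.
Qed.

End density.

Section line.
Context {R : realType}.
Notation mu := (@lebesgue_measure R).
Notation line := (measurableTypeR R).

(** By uniqueness of Lebesgue measure, [|a|] times its image under [x |-> a x + b]
    is Lebesgue measure again. *)
Lemma ge0_integral_affine (a b : R) (f : line -> \bar R) : a != 0 ->
  measurable_fun [set: line] f -> (forall x, 0 <= f x)%E ->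
  (\int[mu]_x f x = `|a|%:E * \int[mu]_x f (a * x + b)%R)%E.
Proof.
move=> a0 mf f0.
pose phi : line -> line := fun x => a * x + b.
have mphi : measurable_fun [set: line] phi.
  by apply: measurable_funD => //; exact: measurable_funM.
have na0 : 0 < `|a| by rewrite normr_gt0.
pose k : {nonneg R} := NngNum (ltW na0).
pose push := measure_function_pushforward__canonical__measure_function_Measure mu mphi.
have E A : measurable A -> mu A = mscale k push A.
  apply: lebesgue_measure_unique => _ [[u v]] _ <-.
  rewrite /= -[RHS]/(`|a|%:E * mu (phi @^-1` `]u, v]))%E.
  have [a_gt0|a_lt0|a_eq0] := ltgtP 0 a; last by rewrite a_eq0 eqxx in a0.
    have -> : phi @^-1` `]u, v] = `](u - b) / a, (v - b) / a]%classic.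
      apply/seteqP; split => x; rewrite /= !in_itv /= /phi;
      by rewrite ltr_pdivrMr// ler_pdivlMr// ltrBlDr lerBrDr mulrC.
    rewrite !lebesgue_measure_itv/= !lte_fin ltr_pM2r ?invr_gt0// ltrD2r.
    case: ifPn => _; rewrite ?mule0// gtr0_norm// -!EFinB -EFinM; congr EFin.
    by field; rewrite gt_eqF.
  have -> : phi @^-1` `]u, v] = `[(v - b) / a, (u - b) / a[%classic.
    apply/seteqP; split => x; rewrite /= !in_itv /= /phi andbC;
    by rewrite ler_ndivrMr// ltr_ndivlMr// ltrBlDr lerBrDr mulrC.
  rewrite !lebesgue_measure_itv/= !lte_fin ltr_nM2r ?invr_lt0// ltrD2r.
  case: ifPn => _; rewrite ?mule0// ltr0_norm// -!EFinB -EFinM; congr EFin.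
  by field; rewrite lt_eqF.
rewrite (eq_measure_integral (mscale k push)); last by move=> A mA _; exact: E.
by rewrite ge0_integral_mscale// ge0_integral_pushforward.
Qed.

End line.

Section plane_measurable.
Context {R : realType}.
Notation plane := (measurableTypeR R * measurableTypeR R)%type.

(** An open set of the plane is a countable union of boxes with rational centres
    and radii [1 / (n + 1)]. *)
Lemma continuous_plane_measurable (f : R * R -> R) : continuous f ->
  measurable_fun [set: plane] (f : plane -> measurableTypeR R).
Proof.
move=> /continuousP cf.
apply: (measurability _ (RGenOpens.measurableE R)).
move=> _ [_ [a [b ->] <-]]; rewrite setTI.
have oU : open (f @^-1` [set` `]a, b[]) by apply: cf; exact: interval_open.
move: (f @^-1` _) oU => U oU.
pose rad (n : nat) : R := n.+1%:R^-1.
pose near_rat (r : rat) n : set (measurableTypeR R) :=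
  `]ratr r - rad n, ratr r + rad n[%classic.
pose box (q : rat * rat * nat) : set plane :=
  near_rat q.1.1 q.2 `*` near_rat q.1.2 q.2.
rewrite (_ : U = \bigcup_(q in [set q | box q `<=` U]) box q); last first.
  apply/seteqP; split => [x Ux|x [q qU /qU]//].
  have /nbhs_ballP[e /= e0 eU] : nbhs x U by exact: open_nbhs_nbhs.
  (* a box of radius [rad n] around a point at distance [< rad n] from [x] lies in
     the ball of radius [e] around [x] *)
  have [n ne] : exists n, rad n < e / 2.
    have e20 : 0 < e / 2 by rewrite divr_gt0.
    by have [n _ hn] := near_infty_natSinv_lt (PosNum e20); exists n; exact: hn n (leqnn n).
  have nn : 0 < rad n by rewrite invr_gt0.
  have H (y : R) : exists r : rat, ratr r - rad n < y < ratr r + rad n.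
    have /rat_in_itvoo[r] : y - rad n < y + rad n by lra.
    rewrite in_itv/= => /andP[h1 h2]; exists r.
    by apply/andP; split; lra.
  have [r1 h1] := H x.1; have [r2 h2] := H x.2.
  exists (r1, r2, n); last by split; rewrite /near_rat /= in_itv.
  move: h1 h2 => /andP[h1 h1'] /andP[h2 h2'] y.
  rewrite /box /near_rat /= !in_itv /= => -[/andP[y1 y1'] /andP[y2 y2']].
  by apply: eU; split; rewrite /ball /= ltr_norml; apply/andP; split; lra.
rewrite bigcup_mkcond; apply: countable_bigcupT_measurable => // q.
case: ifPn => // _; apply: measurableX; exact: measurable_itv.
Qed.

End plane_measurable.

(** * The standard Gaussian on the plane *)

Section plane_integrals.
Context {R : realType}.
Notation line := (measurableTypeR R).
Notation plane := (line * line)%type.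
Notation mu := (@lebesgue_measure R).

Lemma leb2_iterated (f : plane -> \bar R) :
  measurable_fun [set: plane] f -> (forall x, 0 <= f x)%E ->
  (\int[leb2]_x f x = \int[mu]_u \int[mu]_v f (u, v))%E.
Proof. by move=> mf f0; exact: (fubini_tonelli1 f mf f0). Qed.

Lemma measurable_fun_triangular (a b d p q : R) : measurable_fun [set: plane]
  ((fun z : R * R => (a * z.1 + p, b * z.1 + d * z.2 + q)) : plane -> plane).
Proof.
have l1 (c : R) : measurable_fun [set: plane] (fun z : R * R => c * z.1 : R).
  exact: (measurable_funM (measurable_cst c) measurable_fst).
have l2 (c : R) : measurable_fun [set: plane] (fun z : R * R => c * z.2 : R).
  exact: (measurable_funM (measurable_cst c) measurable_snd).
have h1 : measurable_fun [set: plane] (fun z : R * R => a * z.1 + p : R).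
  exact: (measurable_funD (l1 a) (measurable_cst p)).
have h2 : measurable_fun [set: plane] (fun z : R * R => b * z.1 + d * z.2 + q : R).
  exact: (measurable_funD (measurable_funD (l1 b) (l2 d)) (measurable_cst q)).
exact: (measurable_fun_pair h1 h2).
Qed.

(** Triangular maps suffice below: reflections, translations, scalings, and the
    square roots of covariance matrices. They reduce to two substitutions on the
    line. *)
Lemma ge0_integral_triangular (a b d p q : R) (f : plane -> \bar R) : a != 0 -> d != 0 ->
  measurable_fun [set: plane] f -> (forall x, 0 <= f x)%E ->
  (\int[leb2]_x f x =
   `|a * d|%:E * \int[leb2]_z f (a * z.1 + p, b * z.1 + d * z.2 + q)%R)%E.
Proof.
move=> a0 d0 mf f0.
pose fA (z : plane) := f (a * z.1 + p, b * z.1 + d * z.2 + q)%R.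
have fA0 z : (0 <= fA z)%E by exact: f0.
have mfA : measurable_fun [set: plane] fA.
  exact: (measurableT_comp mf (measurable_fun_triangular a b d p q)).
have mF : measurable_fun [set: line] (fun u : line => \int[mu]_v f (u, v))%E.
  exact: (measurable_fun_fubini_tonelli_F f mf f0).
rewrite leb2_iterated// (leb2_iterated mfA fA0).
rewrite (ge0_integral_affine p a0 mF); last by move=> u; exact: integral_ge0.
rewrite normrM EFinM -muleA; congr (_ * _)%E.
rewrite -ge0_integralZl//=; last 2 first.
- exact: (measurable_fun_fubini_tonelli_F fA mfA fA0).
- by move=> u _; exact: integral_ge0.
apply: eq_integral => u _.
rewrite (ge0_integral_affine (b * u + q) d0 _ (fun v => f0 _))//.
  by congr (_ * _)%E; apply: eq_integral => v _; rewrite /fA /= addrA (addrC (d * v)).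
exact: measurableT_comp.
Qed.

Lemma ge0_integral_swap (f : plane -> \bar R) :
  measurable_fun [set: plane] f -> (forall x, 0 <= f x)%E ->
  (\int[leb2]_x f x = \int[leb2]_z f (z.2, z.1))%E.
Proof.
move=> mf f0.
have ms : measurable_fun [set: plane] (fun z : plane => f (z.2, z.1)).
  exact: (measurableT_comp mf (measurable_fun_pair measurable_snd measurable_fst)).
rewrite leb2_iterated//.
by rewrite (fubini_tonelli2 (fun z : plane => f (z.2, z.1)) ms (fun z => f0 _)).
Qed.

Definition std_gauss (z : R * R) : R := (2 * pi)^-1 * expR (- ((z.1 ^+ 2 + z.2 ^+ 2) / 2)).

Lemma std_gauss_ge0 z : 0 <= std_gauss z.
Proof. by rewrite mulr_ge0 ?expR_ge0// invr_ge0 mulr_ge0 ?pi_ge0. Qed.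

Lemma measurable_std_gauss : measurable_fun [set: plane] std_gauss.
Proof.
apply: measurable_funM => //; apply: measurableT_comp => //; apply: measurableT_comp => //.
apply: measurable_funM => //.
by apply: measurable_funD; apply: measurable_funX.
Qed.

Lemma integral_std_gauss : (\int[leb2]_z (std_gauss z)%:E = 1)%E.
Proof.
rewrite leb2_iterated; last 2 first.
- by apply/measurable_EFinP; exact: measurable_std_gauss.
- by move=> z; rewrite lee_fin std_gauss_ge0.
have E u v : std_gauss (u, v) = normal_pdf 0 1 u * normal_pdf 0 1 v.
  rewrite /std_gauss !normal_pdfE ?oner_eq0// /normal_peak /normal_fun /=.
  rewrite !subr0 expr1n mul1r mulrACA -expRD -invfM -expr2 sqr_sqrtr; last first.
    by rewrite mulrn_wge0// ?pi_ge0.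
  by rewrite mulr_natl; congr (_ * expR _); rewrite -mulr_natl mulr1; field.
under eq_integral => u _.
  under eq_integral do rewrite E EFinM.
  rewrite ge0_integralZl//=; last 3 first.
  - apply/measurable_EFinP; exact: measurable_normal_pdf.
  - by move=> v _; rewrite lee_fin normal_pdf_ge0.
  - by rewrite lee_fin normal_pdf_ge0.
  rewrite integral_normal_pdf mule1; over.
exact: integral_normal_pdf.
Qed.

(** The standard Gaussian integral after the scaling [z |-> z / sqrt 2]. *)
Lemma integral_std_gauss_scale : (\int[@leb2 R]_z ((2 * pi)^-1 * expR (- ((z.1 ^+ 2 + z.2 ^+ 2) / 4)))%:E = (2 : R)%:E)%E.
Proof.
pose s : R := (Num.sqrt 2)^-1.
have s0 : s != 0 by rewrite invr_eq0 gt_eqF// sqrtr_gt0.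
have s2 : s ^+ 2 = 2^-1 by rewrite exprVn sqr_sqrtr.
have mpsi : measurable_fun [set: plane] (EFin \o std_gauss).
  by apply/measurable_EFinP; exact: measurable_std_gauss.
have psi0 z : (0 <= (EFin \o std_gauss) z)%E by rewrite lee_fin std_gauss_ge0.
have := ge0_integral_triangular 0 0 0 s0 s0 mpsi psi0.
rewrite integral_std_gauss -expr2 s2 ger0_norm ?invr_ge0// => e.
rewrite -[RHS]mule1 e muleA -EFinM divff// mul1e; apply: eq_integral => z _.
congr EFin; rewrite /std_gauss /= mul0r !addr0 add0r !exprMn s2.
by congr (_ * expR _); field.
Qed.

(** Half of the Gaussian decay absorbs the polynomial:
    [u^2 e^(- u / 2) <= 64 e^(- u / 4)] with [u = |z|^2]. *)
Lemma integral_std_gauss_norm4 : (\int[leb2]_z ((z.1 ^+ 2 + z.2 ^+ 2) ^+ 2 * std_gauss z)%:E < +oo)%E.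
Proof.
pose h (z : plane) : R := (2 * pi)^-1 * expR (- ((z.1 ^+ 2 + z.2 ^+ 2) / 4)).
have h0 z : 0 <= h z by rewrite mulr_ge0 ?expR_ge0// invr_ge0 mulr_ge0 ?pi_ge0.
have msq : measurable_fun [set: plane] (fun z : R * R => z.1 ^+ 2 + z.2 ^+ 2 : R).
  by apply: measurable_funD; apply: measurable_funX.
have mh : measurable_fun [set: plane] h.
  apply: measurable_funM => //; apply: measurableT_comp => //; apply: measurableT_comp => //.
  exact: measurable_funM.
apply: (@le_lt_trans _ _ (\int[leb2]_z (64%:E * (h z)%:E))%E); last first.
  rewrite ge0_integralZl//=.
  - by rewrite integral_std_gauss_scale -EFinM ltry.
  - exact/measurable_EFinP.
  - by move=> z _; rewrite lee_fin.
apply: ge0_le_integral => //.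
- by move=> z _; rewrite lee_fin mulr_ge0 ?sqr_ge0 ?std_gauss_ge0.
- apply/measurable_EFinP; apply: measurable_funM; last exact: measurable_std_gauss.
  exact: measurable_funX.
- by apply/measurable_EFinP; exact: measurable_funM.
move=> z _; rewrite -EFinM lee_fin /std_gauss /h mulrCA [leRHS]mulrCA ler_wpM2l//.
  by rewrite invr_ge0 mulr_ge0 ?pi_ge0.
have : 0 <= z.1 ^+ 2 + z.2 ^+ 2 by rewrite addr_ge0 ?sqr_ge0.
move: (_ + _) => u u0.
(* the square of [u / 8 <= expR (u / 8)] *)
have e : u ^+ 2 <= 64 * expR (u / 4).
  have -> : u / 4 = u / 8 + u / 8 by field.
  rewrite expRD -expr2; have := expR_ge1Dx (u / 8).
  have := expR_gt0 (u / 8); nra.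
have -> : - (u / 2) = - (u / 4) - u / 4 by field.
rewrite expRD expRN mulrA ler_pM2r ?expR_gt0//; last first.
  by rewrite invr_gt0 expR_gt0.
by rewrite ler_pdivrMr ?expR_gt0// .
Qed.

End plane_integrals.

(** * Nondegenerate Gaussian measures *)

(* Unification must not unfold the entries of the covariance matrices. *)
#[local] Opaque Qmx.

Lemma det_mx2 (R : comNzRingType) (A : 'M[R]_2) : \det A = A 0 0 * A 1 1 - A 0 1 * A 1 0.
Proof.
rewrite (expand_det_row _ 0) big_ord_recl big_ord_recl big_ord0 addr0.
rewrite /cofactor !det_mx11 !mxE /= expr0 expr1 mul1r mulN1r mulrN.
by congr (_ * A _ _ - A _ _ * A _ _); apply/val_inj.
Qed.

Section gaussian_theory.
Context {R : realType}.
Notation line := (measurableTypeR R).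
Notation plane := (line * line)%type.
Variables (Q B : 'M[R]_2) (t : \bar R).
Notation S := (Qmx Q B t).
Hypothesis Ssym : S 1 0 = S 0 1.
Hypothesis S00 : 0 < S 0 0.
Hypothesis Sdet : 0 < S 0 0 * S 1 1 - S 0 1 ^+ 2.
Notation g := (gamma Q B t).
Let D := S 0 0 * S 1 1 - S 0 1 ^+ 2.

Lemma det_Qmx : \det S = D.
Proof. by rewrite det_mx2 Ssym -expr2. Qed.

Lemma invmx_Qmx : [/\ invmx S 0 0 = S 1 1 / D, invmx S 0 1 = - S 0 1 / D,
  invmx S 1 0 = - S 0 1 / D & invmx S 1 1 = S 0 0 / D].
Proof.
pose T : 'M[R]_2 := \matrix_(i, j)
  if i == 0 then (if j == 0 then S 1 1 / D else - S 0 1 / D)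
  else (if j == 0 then - S 0 1 / D else S 0 0 / D).
have D0 : D != 0 by rewrite gt_eqF.
have D1 : (S 0 0 * S 1 1 - S 0 1 ^+ 2) / D = 1 by rewrite divff.
have ST : S *m T = 1%:M.
  apply: mx2P; apply: ord2P; rewrite mul2E [T _ _]mxE [X in _ + _ * X]mxE [RHS]mxE /= ?Ssym.
  - by rewrite mulr1n -D1; field.
  - by rewrite mulr0n; field.
  - by rewrite mulr0n; field.
  - by rewrite mulr1n -D1; field.
have [uS _] := mulmx1_unit ST.
have -> : invmx S = T by rewrite -[LHS]mulmx1 -ST mulmxA mulVmx// mul1mx.
by rewrite !mxE.
Qed.

Lemma gauss_pdfE (x : R * R) : gauss_pdf Q B t x = (2 * pi)^-1 * (Num.sqrt D)^-1 *
  expR (- (2^-1 * ((S 1 1 * x.1 ^+ 2 - 2 * S 0 1 * x.1 * x.2 + S 0 0 * x.2 ^+ 2) / D))).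
Proof.
rewrite /gauss_pdf det_Qmx; congr (_ * expR (- (_ * _))).
have [e0 e1 e2 e3] := invmx_Qmx.
rewrite /dotp /mxact /= !mul2E e0 e1 e2 e3 !mxE /=.
by field; rewrite gt_eqF.
Qed.

(* [a], [b], [e] are the entries of the triangular matrix [L = ((a, 0), (b, e))]
   with [L L^T = S]. *)
Let a := Num.sqrt (S 0 0).
Let b := S 0 1 / a.
Let e := Num.sqrt D / a.

Let a_gt0 : 0 < a. Proof. by rewrite sqrtr_gt0. Qed.
Let a2 : a ^+ 2 = S 0 0. Proof. by rewrite sqr_sqrtr// ltW. Qed.
Let e_gt0 : 0 < e. Proof. by rewrite divr_gt0 ?sqrtr_gt0. Qed.
Let ae : a * e = Num.sqrt D. Proof. by rewrite mulrC divfK// gt_eqF. Qed.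

Definition chol (z : R * R) : R * R := (a * z.1, b * z.1 + e * z.2).

(** [a * e] is the Jacobian of the map [chol]. *)
Lemma gauss_pdf_chol z : (a * e) * gauss_pdf Q B t (chol z) = std_gauss z.
Proof.
have sD : 0 < Num.sqrt D by rewrite sqrtr_gt0.
rewrite gauss_pdfE ae /std_gauss mulrA mulrCA mulfV ?mulr1 ?gt_eqF//.
congr (_ * expR _); congr (- _); rewrite mulrC; congr (_ / _).
rewrite /chol /=.
have D2 : D = (a * e) ^+ 2 by rewrite ae sqr_sqrtr// ltW.
have S01 : S 0 1 = a * b by rewrite /b; field; rewrite gt_eqF.
have S11 : S 1 1 = b ^+ 2 + e ^+ 2.
  have : a ^+ 2 * S 1 1 = a ^+ 2 * (b ^+ 2 + e ^+ 2).
    by rewrite mulrDr -!exprMn -S01 -D2 /D a2; ring.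
  by apply/mulfI; rewrite expf_eq0 gt_eqF.
rewrite D2 S11 S01 -a2; field.
by rewrite !gt_eqF.
Qed.

Lemma measurable_chol : measurable_fun [set: plane] (chol : plane -> plane).
Proof.
have := measurable_fun_triangular a b e 0 0; congr (measurable_fun _ _).
by apply/funext => z; rewrite /chol !addr0.
Qed.

Lemma ge0_integral_gamma (f : plane -> \bar R) :
  measurable_fun [set: plane] f -> (forall x, 0 <= f x)%E ->
  (\int[g]_x f x = \int[leb2]_x (f x * (gauss_pdf Q B t x)%:E))%E.
Proof.
move=> mf f0.
exact: (ge0_integral_density (m := leb2) (nu := g) (measurable_gauss_pdf Q B t)
  (@gauss_pdf_ge0 _ Q B t) (fun _ _ => erefl) mf f0).
Qed.

(** The measure is the image of the standard Gaussian under [chol]. *)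
Lemma ge0_integral_gauss (f : plane -> \bar R) :
  measurable_fun [set: plane] f -> (forall x, 0 <= f x)%E ->
  (\int[g]_x f x = \int[leb2]_z (f (chol z) * (std_gauss z)%:E))%E.
Proof.
move=> mf f0; rewrite (ge0_integral_gamma mf f0).
have mp : measurable_fun [set: plane] (EFin \o gauss_pdf Q B t).
  by apply/measurable_EFinP; exact: measurable_gauss_pdf.
have mfp : measurable_fun [set: plane] (fun x => f x * (gauss_pdf Q B t x)%:E)%E.
  exact: emeasurable_funM.
have fp0 x : (0 <= f x * (gauss_pdf Q B t x)%:E)%E.
  by rewrite mule_ge0// lee_fin gauss_pdf_ge0.
have ane : a != 0 by rewrite gt_eqF.
have ene : e != 0 by rewrite gt_eqF.
rewrite (ge0_integral_triangular b 0 0 ane ene mfp fp0) -ge0_integralZl//=; last first.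
  have := measurableT_comp mfp measurable_chol; congr (measurable_fun _ _).
  by apply/funext => z; rewrite /= /chol !addr0.
apply: eq_integral => z _; rewrite !addr0 -/(chol z) muleCA -EFinM.
by rewrite ger0_norm ?gauss_pdf_chol// ltW// mulr_gt0.
Qed.

Lemma gammaT : g setT = 1%E.
Proof.
rewrite -[LHS]mul1e -(integral_cst g measurableT 1%E) ge0_integral_gauss//.
by under eq_integral do rewrite mul1e; exact: integral_std_gauss.
Qed.

(** [whit1] and [whit2] invert [chol]: in these coordinates the measure is the
    standard Gaussian. *)
Definition whit1 (x : R * R) : R := x.1 / a.
Definition whit2 (x : R * R) : R := (x.2 - b * whit1 x) / e.

Lemma whit1_chol z : whit1 (chol z) = z.1.
Proof. by rewrite /whit1 /chol /= mulrC mulKf// gt_eqF. Qed.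

Lemma whit2_chol z : whit2 (chol z) = z.2.
Proof.
by rewrite /whit2 whit1_chol /chol /= (addrC (b * _)) addrK mulrC mulKf// gt_eqF.
Qed.

Lemma chol_whit x : chol (whit1 x, whit2 x) = x.
Proof.
rewrite /chol /= /whit2 {1}/whit1 (mulrC e) divfK ?gt_eqF// (mulrC a) divfK ?gt_eqF//.
by rewrite addrC subrK; case: x.
Qed.

Lemma gauss_pdf_whit x : gauss_pdf Q B t x = std_gauss (whit1 x, whit2 x) / (a * e).
Proof. by rewrite -gauss_pdf_chol chol_whit mulrC mulKf// gt_eqF// mulr_gt0. Qed.

Lemma measurable_whit1 : measurable_fun [set: plane] whit1.
Proof. exact: (measurable_funM measurable_fst (measurable_cst _)). Qed.

Lemma measurable_whit2 : measurable_fun [set: plane] whit2.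
Proof.
apply: measurable_funM => //; apply: measurable_funB; first exact: measurable_snd.
by apply: measurable_funM => //; exact: measurable_whit1.
Qed.

Lemma gamma_reflect (al be de : R) (f : plane -> \bar R) :
  `|al * de| = 1 ->
  (forall x, gauss_pdf Q B t (al * x.1, be * x.1 + de * x.2) = gauss_pdf Q B t x) ->
  measurable_fun [set: plane] f -> (forall x, 0 <= f x)%E ->
  (\int[g]_x f (al * x.1, be * x.1 + de * x.2)%R = \int[g]_x f x)%E.
Proof.
move=> n1 inv mf f0.
have al0 : al != 0 by apply/eqP => al0; move: n1; rewrite al0 mul0r normr0 => /eqP; rewrite eq_sym oner_eq0.
have de0 : de != 0 by apply/eqP => de0; move: n1; rewrite de0 mulr0 normr0 => /eqP; rewrite eq_sym oner_eq0.
pose A (x : plane) : plane := (al * x.1, be * x.1 + de * x.2).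
have mA : measurable_fun [set: plane] A.
  have := measurable_fun_triangular al be de 0 0; congr (measurable_fun _ _).
  by apply/funext => z; rewrite /A !addr0.
have mfA := measurableT_comp mf mA.
rewrite (ge0_integral_gamma mfA (fun x => f0 (A x))) (ge0_integral_gamma mf f0).
have mp : measurable_fun [set: plane] (EFin \o gauss_pdf Q B t).
  by apply/measurable_EFinP; exact: measurable_gauss_pdf.
have mfp : measurable_fun [set: plane] (fun x => f x * (gauss_pdf Q B t x)%:E)%E.
  exact: emeasurable_funM.
have fp0 x : (0 <= f x * (gauss_pdf Q B t x)%:E)%E.
  by rewrite mule_ge0// lee_fin gauss_pdf_ge0.
rewrite (ge0_integral_triangular be 0 0 al0 de0 mfp fp0) n1 mul1e.
by apply: eq_integral => x _; rewrite !addr0 inv.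
Qed.

(** The positive and the negative part of [h] are exchanged by the reflection and
    have the same integral. If that integral is infinite, [\int h] is [0] by the
    convention for undefined real integrals. *)
Lemma Rintegral_odd (al be de : R) (h : plane -> R) :
  `|al * de| = 1 ->
  (forall x, gauss_pdf Q B t (al * x.1, be * x.1 + de * x.2) = gauss_pdf Q B t x) ->
  measurable_fun [set: plane] h ->
  (forall x, h (al * x.1, be * x.1 + de * x.2) = - h x) ->
  \int[g]_x h x = 0.
Proof.
move=> n1 inv mh hN.
have mhE : measurable_fun [set: plane] (EFin \o h) by exact/measurable_EFinP.
rewrite /Rintegral integralE.
rewrite -(gamma_reflect n1 inv (measurable_funepos mhE) (fun x => funepos_ge0 _ x)).
have -> : (\int[g]_x (EFin \o h)^\+ (al * x.1, be * x.1 + de * x.2)%R =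
    \int[g]_x (EFin \o h)^\- x)%E.
  by apply: eq_integral => x _; rewrite funeposE funenegE /= hN.
by case: (\int[g]_x (EFin \o h)^\- x)%E => [r||]//=; rewrite subrr.
Qed.

Lemma gauss_pdf_even x : gauss_pdf Q B t (-1 * x.1, 0 * x.1 + -1 * x.2) = gauss_pdf Q B t x.
Proof.
rewrite (gauss_pdfE x) gauss_pdfE [(_, _).1]/= [(_, _).2]/=.
by rewrite !mulN1r mul0r add0r !sqrrN mulrN (mulrN (2 * _)) mulNr opprK.
Qed.

Lemma Rintegral_gamma_odd (h : plane -> R) : measurable_fun [set: plane] h ->
  (forall x, h (- x.1, - x.2) = - h x) -> \int[g]_x h x = 0.
Proof.
move=> mh hN; apply: (Rintegral_odd (al := -1) (be := 0) (de := -1)) => //.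
- by rewrite mulrNN mulr1 normr1.
- exact: gauss_pdf_even.
- by move=> x; rewrite !mulN1r mul0r add0r.
Qed.

Lemma Lfun2_dominated (h k : plane -> R) : measurable_fun [set: plane] h ->
  k \in Lfun g 2%:E -> (forall x, `|h x| <= `|k x|) -> h \in Lfun g 2%:E.
Proof.
move=> mh k2 hk; have mk := Lfun2_measurable k2; apply: Lfun2P => //.
have /integrableP[_] := Lfun2_integrable_sqr k2; apply: le_lt_trans.
apply: ge0_le_integral => //.
- by move=> x _; rewrite lee_fin sqr_ge0.
- by apply/measurable_EFinP; exact: measurable_funX.
- by apply: measurableT_comp => //; apply/measurable_EFinP; exact: measurable_funX.
move=> x _; rewrite /= lee_fin (ger0_norm (sqr_ge0 _)) -(real_normK (num_real (h x))).
by rewrite -(real_normK (num_real (k x))) lerXn2r// nnegrE.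
Qed.

(** Square integrable by the fourth moments of the Gaussian; it dominates every
    polynomial of degree at most two used below. *)
Definition whitsq (x : R * R) : R := whit1 x ^+ 2 + whit2 x ^+ 2.

Lemma measurable_whitsq : measurable_fun [set: plane] whitsq.
Proof.
apply: measurable_funD; apply: measurable_funX.
  exact: measurable_whit1.
exact: measurable_whit2.
Qed.

Lemma Lfun2_whitsq : whitsq \in Lfun g 2%:E.
Proof.
have mw := measurable_whitsq; apply: Lfun2P => //.
rewrite ge0_integral_gauss.
- apply: le_lt_trans integral_std_gauss_norm4; rewrite le_eqVlt; apply/orP; left; apply/eqP.
  by apply: eq_integral => z _; rewrite /whitsq whit1_chol whit2_chol EFinM.
- by apply/measurable_EFinP; exact: measurable_funX.
- by move=> x; rewrite lee_fin sqr_ge0.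
Qed.

Lemma Lfun2_cst (c : R) : (fun=> c : R) \in Lfun g 2%:E.
Proof. 
apply: Lfun2P => //; rewrite integral_cst//.
by rewrite [X in (_ * X)%E](_ : _ = 1%E) ?mule1 ?ltry//; exact: gammaT.
Qed.

Lemma Lfun2_whit1 : whit1 \in Lfun g 2%:E.
Proof.
apply: (Lfun2_dominated measurable_whit1 (Lfun2D (Lfun2_cst 1) Lfun2_whitsq)) => x.
rewrite [leRHS]ger0_norm /whitsq ?addr_ge0 ?sqr_ge0// ler_norml.
by apply/andP; split; nra.
Qed.

Lemma Lfun2_whit2 : whit2 \in Lfun g 2%:E.
Proof.
apply: (Lfun2_dominated measurable_whit2 (Lfun2D (Lfun2_cst 1) Lfun2_whitsq)) => x.
rewrite [leRHS]ger0_norm /whitsq ?addr_ge0 ?sqr_ge0// ler_norml.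
by apply/andP; split; nra.
Qed.

(** The reflection [whit1 |-> - whit1] is, in the original coordinates, the
    triangular map with entries [-1], [- 2 b / a], [1]. *)
Lemma ip_whit12 : ip g whit1 whit2 = 0.
Proof.
have n1 (x : R * R) y : whit1 (-1 * x.1, y) = - whit1 x.
  by rewrite /whit1 [(_, _).1]/= mulN1r mulNr.
have n2 (x : R * R) : whit2 (-1 * x.1, - (2 * b / a) * x.1 + 1 * x.2) = whit2 x.
  rewrite /whit2 n1 [(_, _).2]/=; congr (_ / _); rewrite /whit1.
  have aux (a' b' u v : R) : a' != 0 ->
    - (2 * b' / a') * u + 1 * v - b' * - (u / a') = v - b' * (u / a').
    by move=> a'0; field.
  by apply: aux; rewrite gt_eqF.
apply: (Rintegral_odd (al := -1) (be := - (2 * b / a)) (de := 1)).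
- by rewrite mulr1 normrN1.
- by move=> x; rewrite !gauss_pdf_whit n1 n2 /std_gauss sqrrN.
- by apply: measurable_funM; [exact: measurable_whit1|exact: measurable_whit2].
- by move=> x; rewrite n1 n2 mulNr.
Qed.

Let ipE (w : plane -> R) : measurable_fun [set: plane] w -> 
  (\int[g]_x (w x * w x)%:E = \int[leb2]_z (w (chol z) ^+ 2 * std_gauss z)%:E)%E.
Proof.
move=> mw; rewrite ge0_integral_gauss//.
- by apply/measurable_EFinP; exact: measurable_funM.
- by move=> x; rewrite lee_fin -expr2 sqr_ge0.
Qed.

Lemma ip_whit22 : ip g whit2 whit2 = ip g whit1 whit1.
Proof.
rewrite /ip /Rintegral (ipE measurable_whit1) (ipE measurable_whit2); congr fine.
under eq_integral do rewrite whit2_chol.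
under [in RHS]eq_integral do rewrite whit1_chol.
pose h (z : plane) : \bar R := (z.2 ^+ 2 * std_gauss z)%:E.
have mh : measurable_fun [set: plane] h.
  apply/measurable_EFinP; apply: measurable_funM; last exact: measurable_std_gauss.
  exact: measurable_funX.
have h0 z : (0 <= h z)%E by rewrite lee_fin mulr_ge0 ?sqr_ge0 ?std_gauss_ge0.
transitivity (\int[leb2]_z h z)%E => //; rewrite (ge0_integral_swap mh h0).
by apply: eq_integral => z _; rewrite /h /std_gauss [(_, _).1]/= [(_, _).2]/= (addrC (z.2 ^+ 2)).
Qed.

(** Integrating [1 - (3/2) z1^2 <= e^(- (3/2) z1^2)] against the standard Gaussian
    gives [1 - (3/2) m <= 1/2] for the second moment [m], because
    [e^(- (3/2) z1^2)] times the density at [z] is the density at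
    [(2 z1, z2)]. *)
Lemma ip_whit11_gt0 : 0 < ip g whit1 whit1.
Proof.
have fin := integrable_fin_num measurableT (Lfun2_integrableM Lfun2_whit1 Lfun2_whit1).
have mE : (\int[leb2]_z (z.1 ^+ 2 * std_gauss z)%:E = (ip g whit1 whit1)%:E)%E.
  rewrite /ip /Rintegral fineK// ipE; last exact: measurable_whit1.
  by apply: eq_integral => z _; rewrite whit1_chol.
have mpsi : measurable_fun [set: plane] (EFin \o std_gauss).
  by apply/measurable_EFinP; exact: measurable_std_gauss.
have psi0 (z : plane) : (0 <= (EFin \o std_gauss) z)%E by rewrite lee_fin std_gauss_ge0.
have two0 : 2 != 0 :> R by rewrite pnatr_eq0.
pose k (z : plane) : R := std_gauss (2 * z.1, z.2).
have mk : measurable_fun [set: plane] k.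
  have h1 : measurable_fun [set: plane] (fun z : R * R => 2 * z.1 : R).
    exact: (measurable_funM (measurable_cst _) measurable_fst).
  exact: (measurableT_comp measurable_std_gauss (measurable_fun_pair h1 measurable_snd)).
have half : (\int[leb2]_z (k z)%:E = (2^-1)%:E)%E.
  have := ge0_integral_triangular 0 0 0 two0 (oner_neq0 R) mpsi psi0.
  rewrite integral_std_gauss mulr1 ger0_norm// => e2.
  transitivity ((2^-1 : R)%:E * 1)%E; last by rewrite mule1.
  rewrite [in RHS]e2 muleA -EFinM mulVf// mul1e; apply: eq_integral => z _.
  by rewrite /k /= mul0r !addr0 add0r mul1r.
have mz : measurable_fun [set: plane] (fun z : R * R => z.1 ^+ 2 * std_gauss z : R).
  by apply: measurable_funM; [exact: measurable_funX|exact: measurable_std_gauss].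
have : (1%:E <= (2^-1)%:E + (3 / 2)%:E * (ip g whit1 whit1)%:E)%E.
  rewrite -integral_std_gauss -half -mE -ge0_integralZl//=; last 2 first.
  - exact/measurable_EFinP.
  - by move=> z _; rewrite lee_fin mulr_ge0 ?sqr_ge0 ?std_gauss_ge0.
  rewrite -ge0_integralD//=; last 4 first.
  - by move=> z _; rewrite lee_fin std_gauss_ge0.
  - exact/measurable_EFinP.
  - move=> z _; apply: mule_ge0; rewrite lee_fin ?divr_ge0//.
    by rewrite mulr_ge0 ?sqr_ge0 ?std_gauss_ge0.
  - by apply/measurable_EFinP; exact: measurable_funM.
  apply: ge0_le_integral => //.
  - by move=> z _; exact: psi0.
  - apply: emeasurable_funD; first exact/measurable_EFinP.
    by apply: measurable_funeM; exact/measurable_EFinP.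
  move=> z _; rewrite -EFinM -EFinD lee_fin.
  have -> : k z = expR (- (3 / 2 * z.1 ^+ 2)) * std_gauss z.
    by rewrite /k /std_gauss mulrCA -expRD /=; congr (_ * expR _); field.
  have aux (x p s : R) : 0 <= p -> 1 + - (3 / 2 * s) <= x -> p <= x * p + 3 / 2 * (s * p).
    move=> p0 xs; rewrite -subr_ge0.
    have -> : x * p + 3 / 2 * (s * p) - p = (x - (1 - 3 / 2 * s)) * p by ring.
    by rewrite mulr_ge0// subr_ge0.
  exact: (aux _ _ _ (std_gauss_ge0 z) (expR_ge1Dx _)).
by rewrite -EFinM -EFinD lee_fin; lra.
Qed.

Definition lform (u x : R * R) : R := u.1 * x.1 + u.2 * x.2.

Lemma measurable_lform u : measurable_fun [set: plane] (lform u).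
Proof.
apply: measurable_funD.
  exact: (measurable_funM (measurable_cst _) measurable_fst).
exact: (measurable_funM (measurable_cst _) measurable_snd).
Qed.

Lemma lform_whit u x : lform u x =
  (u.1 * a + u.2 * b) * whit1 x + (u.2 * e) * whit2 x.
Proof.
by rewrite /lform -{1 2}(chol_whit x) /chol /=; ring.
Qed.

Lemma Lfun2_lform u : lform u \in Lfun g 2%:E.
Proof.
have -> : lform u = (fun x => (u.1 * a + u.2 * b) * whit1 x + (u.2 * e) * whit2 x).
  by apply/funext => x; rewrite lform_whit.
by apply: Lfun2D; apply: Lfun2Z; [exact: Lfun2_whit1|exact: Lfun2_whit2].
Qed.

Lemma Lfun2_lform_sqr u : (fun x => lform u x ^+ 2) \in Lfun g 2%:E.
Proof.
set p := u.1 * a + u.2 * b; set q := u.2 * e.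
apply: (Lfun2_dominated _ (Lfun2Z (2 * (p ^+ 2 + q ^+ 2)) Lfun2_whitsq)).
  by apply: measurable_funX; exact: measurable_lform.
move=> x; rewrite lform_whit -/p -/q ger0_norm ?sqr_ge0//.
have h : 0 <= whitsq x by rewrite addr_ge0 ?sqr_ge0.
rewrite ger0_norm; last by rewrite !mulr_ge0// addr_ge0 ?sqr_ge0.
rewrite /whitsq; move: (whit1 x) (whit2 x) => w v.
have := sqr_ge0 (p * v - q * w); have := sqr_ge0 (p * w); have := sqr_ge0 (q * v).
have := sqr_ge0 (p * v); have := sqr_ge0 (q * w); lra.
Qed.

(** The coordinates [whit1], [whit2] are orthogonal with the same square norm, so
    the pairing of the forms is that of their coefficients, [u L L^T v^T]. *)
Lemma ip_lform u v : ip g (lform u) (lform v) = ip g whit1 whit1 *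
  (u.1 * v.1 * S 0 0 + (u.1 * v.2 + u.2 * v.1) * S 0 1 + u.2 * v.2 * S 1 1).
Proof.
have w1 := Lfun2_whit1; have w2 := Lfun2_whit2.
have -> : lform u = (fun x => (u.1 * a + u.2 * b) * whit1 x + (u.2 * e) * whit2 x).
  by apply/funext => x; rewrite lform_whit.
have -> : lform v = (fun x => (v.1 * a + v.2 * b) * whit1 x + (v.2 * e) * whit2 x).
  by apply/funext => x; rewrite lform_whit.
rewrite ipDl ?ipDr ?Lfun2D ?Lfun2Z// !ipZl ?Lfun2Z// !ipZr//.
rewrite (ipC g whit2 whit1) ip_whit12 ip_whit22.
have ab : a * b = S 0 1 by rewrite /b; field; rewrite gt_eqF.
have S11 : b ^+ 2 + e ^+ 2 = S 1 1.
  have : a ^+ 2 * (b ^+ 2 + e ^+ 2) = a ^+ 2 * S 1 1.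
    by rewrite mulrDr -!exprMn ab ae sqr_sqrtr ?ltW// /D a2; ring.
  by apply/mulfI; rewrite expf_eq0 gt_eqF.
rewrite -S11 -ab -a2; ring.
Qed.

Lemma Rintegral_lform u : \int[g]_x lform u x = 0.
Proof.
apply: Rintegral_gamma_odd; first exact: measurable_lform.
by move=> x; rewrite /lform /=; ring.
Qed.

End gaussian_theory.

(** * The Ornstein-Uhlenbeck semigroup on bounded functions *)

Section leb2_sigma_finite.
Context {R : realType}.
Notation line := (measurableTypeR R).
Notation plane := (line * line)%type.

Lemma sigma_finite_leb2 : sigma_finite [set: plane] (@leb2 R).
Proof.
have /sigma_finiteP[F [TF ndF Foo]] := sigma_finiteT (@lebesgue_measure R).
exists (fun n => F n `*` F n).
  apply/seteqP; split => // -[x y] _.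
  have : [set: line] x by [].
  rewrite TF => -[n _ Fnx]; have : [set: line] y by [].
  rewrite TF => -[k _ Fky]; exists (maxn n k) => //; split => /=.
    by move: x Fnx; exact/subsetPset/ndF/leq_maxl.
  by move: y Fky; exact/subsetPset/ndF/leq_maxr.
move=> k; have [mF fF] := Foo k; split; first exact: measurableX.
by rewrite /leb2 /= product_measure1E//= lte_mul_pinfty// ge0_fin_numE.
Qed.

(** [leb2] with its sigma-finiteness, for Tonelli's theorem on pairs of points of
    the plane. *)
Definition leb2_sf : {sigma_finite_measure set plane -> \bar R} :=
  HB.pack_for {sigma_finite_measure set plane -> \bar R} (Measure.sort (@leb2 R))
    (Measure_isSigmaFinite.Build _ _ _ (@leb2 R) sigma_finite_leb2).

End leb2_sigma_finite.

Section real_semigroup.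
Context {R : realType}.
Notation line := (measurableTypeR R).
Notation plane := (line * line)%type.
Variables (B : 'M[R]_2) (b1 b2 : R).
Hypothesis b12 : b1 != b2.
Hypotheses (b1_lt0 : b1 < 0) (b2_lt0 : b2 < 0).
Hypothesis trB : B 0 0 + B 1 1 = b1 + b2.
Hypothesis detB : B 0 0 * B 1 1 - B 0 1 * B 1 0 = b1 * b2.
Notation g t := (gamma 1%:M B t).
Notation pdf t := (gauss_pdf 1%:M B t).

Lemma mxactE (A : 'M[R]_2) x :
  mxact A x = (A 0 0 * x.1 + A 0 1 * x.2, A 1 0 * x.1 + A 1 1 * x.2).
Proof. by rewrite /mxact !mul2E !mxE. Qed.

Lemma measurable_mxact (A : 'M[R]_2) : measurable_fun [set: plane] (mxact A : plane -> plane).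
Proof.
have l (c d : R) : measurable_fun [set: plane] (fun z : R * R => c * z.1 + d * z.2 : R).
  apply: measurable_funD.
    exact: (measurable_funM (measurable_cst c) measurable_fst).
  exact: (measurable_funM (measurable_cst d) measurable_snd).
have := measurable_fun_pair (l (A 0 0) (A 0 1)) (l (A 1 0) (A 1 1)).
by congr (measurable_fun _ _); apply/funext => x; rewrite mxactE.
Qed.

Lemma measurable_drift (A : 'M[R]_2) : measurable_fun [set: plane * plane]
  ((fun w => mxact A w.1 - w.2) : plane * plane -> plane).
Proof.
have m1 : measurable_fun [set: plane * plane] (fun w : plane * plane => mxact A w.1).
  exact: (measurableT_comp (measurable_mxact A) measurable_fst).
have m2 := @measurable_snd _ _ plane plane.
apply: measurable_fun_pair.
  apply: measurable_funB.
    exact: (measurableT_comp measurable_fst m1).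
  exact: (measurableT_comp measurable_fst m2).
apply: measurable_funB.
  exact: (measurableT_comp measurable_snd m1).
exact: (measurableT_comp measurable_snd m2).
Qed.

Lemma measurable_drift1 (A : 'M[R]_2) x : measurable_fun [set: plane]
  ((fun y => mxact A x - y) : plane -> plane).
Proof.
have mp : measurable_fun [set: plane] ((fun y => (x, y)) : plane -> plane * plane).
  by apply: measurable_fun_pair; [exact: measurable_cst|exact: measurable_id].
exact: (measurableT_comp (measurable_drift A) mp).
Qed.

(** The semigroup on real functions; [ou_bc] acts by it on real and imaginary
    parts. *)
Definition ouR (t : R) (f : plane -> R) (x : R * R) : R :=
  \int[g t%:E]_y f (mxact (expm (t *: B)) x - y).

Section fixed_time.
Variable t : \bar R.
Hypothesis t_gt0 : (0 < t)%E.

Let pd := Qmx_posdef b12 b1_lt0 b2_lt0 trB detB t_gt0.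

Lemma ou_gammaT : g t setT = 1%E.
Proof. by case: pd => h1 h2 h3; exact: gammaT. Qed.

Lemma Lfun2_bounded (M : R) (h : plane -> R) : measurable_fun [set: plane] h ->
  (forall x, `|h x| <= M) -> h \in Lfun (g t) 2%:E.
Proof.
move=> mh hM; case: pd => h1 h2 h3.
apply: (Lfun2_dominated mh (Lfun2_cst h1 h2 h3 M)) => x.
by rewrite (le_trans (hM x))// ler_norm.
Qed.

Lemma Lfun2_integrable (h : plane -> R) : h \in Lfun (g t) 2%:E ->
  (g t).-integrable setT (EFin \o h).
Proof.
move=> h2; case: pd => e1 e2 e3.
have := Lfun2_integrableM h2 (Lfun2_cst e1 e2 e3 1).
by apply: eq_integrable => // x _; rewrite /= mulr1.
Qed.

Lemma Rintegral_gamma_cst (c : R) : \int[g t]_x c = c.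
Proof.
by rewrite Rintegral_cst// [X in fine X](_ : _ = 1%E) ?mulr1//; exact: ou_gammaT.
Qed.

End fixed_time.

Section positive_time.
Variable t : R.
Hypothesis t_gt0 : 0 < t.
Notation E := (expm (t *: B)).
Let tE : (0 < t%:E)%E. Proof. by rewrite lte_fin. Qed.

Lemma measurable_drift_comp (f : plane -> R) x : measurable_fun [set: plane] f ->
  measurable_fun [set: plane] (fun y : plane => f (mxact E x - y)).
Proof. by move=> mf; exact: (measurableT_comp mf (measurable_drift1 E x)). Qed.

Lemma ouR_integrable (f : plane -> R) M x : measurable_fun [set: plane] f ->
  (forall x, `|f x| <= M) ->
  (g t%:E).-integrable setT (EFin \o (fun y : plane => f (mxact E x - y))).
Proof.
move=> mf fM; apply: Lfun2_integrable => //.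
by apply: (@Lfun2_bounded _ _ M) => //; exact: measurable_drift_comp.
Qed.

(** The substitution [z = e^(tB) x - y] exhibits the transition density. *)
Lemma ouR_ge0E (f : plane -> R) (M : R) x : measurable_fun [set: plane] f ->
  (forall x, 0 <= f x) -> (forall x, f x <= M) ->
  (ouR t f x)%:E = (\int[leb2]_z (f z * pdf t%:E (mxact E x - z)%R)%:E)%E.
Proof.
move=> mf f0 fM.
have fin : (\int[g t%:E]_y (f (mxact E x - y)%R)%:E)%E \is a fin_num.
  apply: integrable_fin_num => //; apply: (@ouR_integrable f M) => // y.
  by rewrite ger0_norm.
rewrite /ouR /Rintegral fineK//.
have mfd := measurable_drift_comp x mf.
pose h1 (y : plane) : \bar R := (f (mxact E x - y)%R)%:E.
have mh1 : measurable_fun [set: plane] h1 by apply/measurable_EFinP.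
have h10 y : (0 <= h1 y)%E by rewrite lee_fin.
transitivity (\int[g t%:E]_y h1 y)%E; first reflexivity.
rewrite (ge0_integral_gamma _ _ _ mh1 h10).
pose h (y : plane) : \bar R := (h1 y * (pdf t%:E y)%:E)%E.
have mh : measurable_fun [set: plane] h.
  by apply: emeasurable_funM => //; apply/measurable_EFinP; exact: measurable_gauss_pdf.
have h0 y : (0 <= h y)%E by rewrite mule_ge0// lee_fin gauss_pdf_ge0.
transitivity (\int[leb2]_y h y)%E; first reflexivity.
have n1 : -1 != 0 :> R by rewrite oppr_eq0 oner_eq0.
rewrite (ge0_integral_triangular 0 (mxact E x).1 (mxact E x).2 n1 n1 mh h0).
rewrite mulrNN mulr1 normr1 mul1e; apply: eq_integral => z _.
have e : (-1 * z.1 + (mxact E x).1, 0 * z.1 + -1 * z.2 + (mxact E x).2) = mxact E x - z.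
  by rewrite !mulN1r mul0r add0r !(addrC (- _)).
rewrite e /h /h1 -EFinM; congr EFin; congr (f _ * _).
exact: subKr.
Qed.

Lemma ouRD (f h : plane -> R) M M' x : measurable_fun [set: plane] f ->
  measurable_fun [set: plane] h -> (forall x, `|f x| <= M) -> (forall x, `|h x| <= M') ->
  ouR t (fun y => f y + h y) x = ouR t f x + ouR t h x.
Proof.
move=> mf mh fM hM; rewrite /ouR RintegralD//.
  exact: (ouR_integrable _ mf fM).
exact: (ouR_integrable _ mh hM).
Qed.

Lemma ouR_cst (c : R) x : ouR t (fun=> c) x = c.
Proof. exact: Rintegral_gamma_cst. Qed.

Lemma ouR_bound (f : plane -> R) M x : measurable_fun [set: plane] f ->
  (forall x, `|f x| <= M) -> `|ouR t f x| <= M.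
Proof.
move=> mf fM; have ifx := ouR_integrable x mf fM.
apply: le_trans (le_normr_Rintegral measurableT ifx) _.
rewrite -[leRHS](Rintegral_gamma_cst tE); apply: le_Rintegral => //.
  exact: integrable_norm.
apply: Lfun2_integrable => //; apply: (@Lfun2_bounded _ tE `|M|) => //.
Qed.

Lemma measurable_ouR_ge0 (f : plane -> R) M : measurable_fun [set: plane] f ->
  (forall x, 0 <= f x) -> (forall x, f x <= M) -> measurable_fun [set: plane] (ouR t f).
Proof.
move=> mf f0 fM; apply/measurable_EFinP.
pose h (w : plane * plane) : \bar R := (f w.2 * pdf t%:E (mxact E w.1 - w.2)%R)%:E.
have mh : measurable_fun [set: plane * plane] h.
  apply/measurable_EFinP; apply: measurable_funM.
    exact: (measurableT_comp mf measurable_snd).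
  exact: (measurableT_comp (measurable_gauss_pdf _ _ _) (measurable_drift E)).
have h0 w : (0 <= h w)%E by rewrite lee_fin mulr_ge0// gauss_pdf_ge0.
have -> : EFin \o ouR t f = (fun x => \int[leb2]_z h (x, z))%E.
  by apply/funext => x; rewrite /= (ouR_ge0E x mf f0 fM).
exact: (measurable_fun_fubini_tonelli_F (m2 := leb2_sf) h mh h0).
Qed.

(** Adding the bound [M] to [f] reduces to nonnegative functions, since constants
    are preserved. *)
Lemma measurable_ouR (f : plane -> R) M : measurable_fun [set: plane] f ->
  (forall x, `|f x| <= M) -> measurable_fun [set: plane] (ouR t f).
Proof.
move=> mf fM.
have M0 : 0 <= M by apply: le_trans (fM 0).
have mfM : measurable_fun [set: plane] (fun x => f x + M) by exact: measurable_funD.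
have e : ouR t f = (fun x => ouR t (fun y => f y + M) x - M).
  apply/funext => x; rewrite (@ouRD f (fun=> M) M `|M|)//.
  by rewrite ouR_cst addrK.
rewrite e; apply: measurable_funB => //.
apply: (@measurable_ouR_ge0 _ (M + M)) => // x.
  by have := fM x; rewrite ler_norml => /andP[]; lra.
by have := fM x; rewrite ler_norml => /andP[]; lra.
Qed.

End positive_time.
End real_semigroup.

(** * Reversibility for a symmetric drift matrix *)

Section bilinear.
Context {R : realType}.
Implicit Types (A : 'M[R]_2) (x y z : R * R).

Definition bform A x z : R := ((colv x)^T *m A *m colv z) 0 0.

Lemma colvB x z : colv (x - z) = colv x - colv z.
Proof. by apply: mx2P => j; rewrite !mxE. Qed.

Lemma colv_mxact A x : colv (mxact A x) = A *m colv x.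
Proof. by apply: mx2P => j; rewrite mxE /mxact /= ord1. Qed.

Lemma dotp_bform A x : dotp (mxact A x) x = bform A x x.
Proof. by rewrite /dotp /mxact /bform /= !mul2E !mxE /=; ring. Qed.

Lemma bformC A x z : A^T = A -> bform A x z = bform A z x.
Proof.
move=> sA; rewrite /bform.
have -> : (colv x)^T *m A *m colv z = ((colv z)^T *m A *m colv x)^T.
  by rewrite !trmx_mul trmxK sA mulmxA.
by rewrite mxE.
Qed.

Lemma bformBl A x y z : bform A (x - y) z = bform A x z - bform A y z.
Proof.
rewrite /bform colvB; have -> : (colv x - colv y)^T = (colv x)^T - (colv y)^T.
  by apply/matrixP => i j; rewrite !mxE.
by rewrite !mulmxBl [LHS]mxE [X in _ + X]mxE.
Qed.

Lemma bformBr A x y z : bform A z (x - y) = bform A z x - bform A z y.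
Proof. by rewrite /bform colvB mulmxBr [LHS]mxE [X in _ + X]mxE. Qed.

Lemma bform_mxactr A E e x z : A *m E = e *: A -> bform A z (mxact E x) = e * bform A z x.
Proof.
move=> AE; rewrite /bform colv_mxact mulmxA -(mulmxA (colv z)^T) AE -scalemxAr -scalemxAl.
by rewrite [LHS]mxE.
Qed.

(** [E] acts on the range of [A] as multiplication by [e]. *)
Lemma bform_drift A E e x z : A^T = A -> A *m E = e *: A ->
  bform A (mxact E x - z) (mxact E x - z) =
  e ^+ 2 * bform A x x - 2 * e * bform A x z + bform A z z.
Proof.
move=> sA AE; rewrite bformBr !bformBl !(bform_mxactr _ _ AE).
rewrite !(bformC (mxact E x) _ sA) !(bform_mxactr _ _ AE) (bformC z x sA).
by ring.
Qed.

End bilinear.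

Section symmetric_semigroup.
Context {R : realType}.
Notation line := (measurableTypeR R).
Notation plane := (line * line)%type.
Variables (B : 'M[R]_2) (b1 b2 : R).
Hypothesis b12 : b1 != b2.
Hypotheses (b1_lt0 : b1 < 0) (b2_lt0 : b2 < 0).
Hypothesis trB : B 0 0 + B 1 1 = b1 + b2.
Hypothesis detB : B 0 0 * B 1 1 - B 0 1 * B 1 0 = b1 * b2.
Hypothesis symB : B^T = B.
Notation g t := (gamma 1%:M B t).
Notation pdf t := (gauss_pdf 1%:M B t).
Notation p1 := (specproj B b1 b2).
Notation p2 := (specproj B b2 b1).

Let sp1 : p1^T = p1. Proof. by rewrite -specproj_tr symB. Qed.
Let sp2 : p2^T = p2. Proof. by rewrite -specproj_tr symB. Qed.

(** The spectral projections of a symmetric matrix are symmetric and mutually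
    annihilating, so the covariance is diagonal in them. *)
Lemma invmx_Qmx_sym (t : \bar R) : (0 < t)%E ->
  invmx (Qmx 1%:M B t) = (exp_int (b1 + b1) t)^-1 *: p1 + (exp_int (b2 + b2) t)^-1 *: p2.
Proof.
move=> t0.
have c1 : 0 < exp_int (b1 + b1) t by apply: exp_int_gt0 => //; move: b1_lt0; lra.
have c2 : 0 < exp_int (b2 + b2) t by apply: exp_int_gt0 => //; move: b2_lt0; lra.
have SE : Qmx 1%:M B t = exp_int (b1 + b1) t *: p1 + exp_int (b2 + b2) t *: p2.
  rewrite (Qmx_spectral b12 b1_lt0 b2_lt0 trB detB t0) sp1 sp2.
  rewrite (specproj_idl b12 trB detB) (specproj_idr b12 trB detB).
  by rewrite (mul_specproj trB detB) (mul_specprojC trB detB) addr0 scaler0 addr0.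
set T := (X in _ = X).
have ST : Qmx 1%:M B t *m T = 1%:M.
  rewrite SE /T -(specprojD B b12).
  have := specproj_idl b12 trB detB; have := specproj_idr b12 trB detB.
  have := mul_specproj trB detB; have := mul_specprojC trB detB.
  move: p1 p2 (exp_int _ t) c1 (exp_int _ t) c2 => q1 q2 c c0 d d0 q21 q12 q22 q11.
  rewrite mulmxDl !mulmxDr -!scalemxAl -!scalemxAr q21 q12 q22 q11.
  by rewrite !scaler0 addr0 add0r !scalerA !mulfV ?gt_eqF// !scale1r.
have [uS _] := mulmx1_unit ST.
transitivity (invmx (Qmx 1%:M B t) *m (Qmx 1%:M B t *m T)); first by rewrite ST mulmx1.
by rewrite mulmxA mulVmx// mul1mx.
Qed.

(** [pdf t (e^(tB) x - z)] is the density of the transition from [x] to [z]. Along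
    each eigendirection the symmetry amounts to
    [e^(2tb) / c_t + 1 / c_oo = 1 / c_t] with [c_t = (1 - e^(2tb)) / (- 2b)]. *)
Lemma detailed_balance (t : R) x z : 0 < t ->
  pdf t%:E (mxact (expm (t *: B)) x - z) * pdf +oo x =
  pdf t%:E (mxact (expm (t *: B)) z - x) * pdf +oo z.
Proof.
move=> t0; have tE : (0 < t%:E)%E by rewrite lte_fin.
have EE := expm_spectral b12 trB detB t.
have e1 : p1 *m expm (t *: B) = expR (t * b1) *: p1.
  have := specproj_idl b12 trB detB; have := mul_specproj trB detB.
  rewrite EE; move: p1 p2 => q1 q2 q12 q11.
  by rewrite mulmxDr -!scalemxAr q12 q11 scaler0 addr0.
have e2 : p2 *m expm (t *: B) = expR (t * b2) *: p2.
  have := specproj_idr b12 trB detB; have := mul_specprojC trB detB.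
  rewrite EE; move: p1 p2 => q1 q2 q21 q22.
  by rewrite mulmxDr -!scalemxAr q21 q22 scaler0 add0r.
have qf s y : (0 < s)%E -> dotp (mxact (invmx (Qmx 1%:M B s)) y) y =
    (exp_int (b1 + b1) s)^-1 * bform p1 y y + (exp_int (b2 + b2) s)^-1 * bform p2 y y.
  move=> s0; rewrite dotp_bform (invmx_Qmx_sym s0) /bform.
  rewrite mulmxDr mulmxDl -!scalemxAr -!scalemxAl.
  by rewrite [LHS]mxE [X in X + _]mxE [X in _ + X]mxE.
have bal b : b < 0 ->
    (exp_int (b + b) t%:E)^-1 * expR (t * b) ^+ 2 + (exp_int (b + b) +oo)^-1 =
    (exp_int (b + b) t%:E)^-1.
  move=> b0; have bb : b + b < 0 by lra.
  rewrite exp_inty// exp_int_fin// mulrDr expRD -expr2.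
  have : expR (t * b) ^+ 2 < 1.
    by rewrite expr_lt1 ?expR_ge0// expR_lt1 nmulr_llt0.
  move: (expR _ ^+ 2) => u u1; field.
  by rewrite -mulr2n mulrn_eq0 /= lt_eqF//= subr_eq0 eq_sym lt_eqF.
pose K s : R := (2 * pi)^-1 * (Num.sqrt (\det (Qmx 1%:M B s)))^-1.
have pdfE s y : (0 < s)%E -> pdf s y = K s * expR (- (2^-1 *
    ((exp_int (b1 + b1) s)^-1 * bform p1 y y + (exp_int (b2 + b2) s)^-1 * bform p2 y y))).
  by move=> s0; rewrite -(qf _ _ s0).
have aux (k k' a1 a2 c1 c2 u1 u2 X1 X2 Z1 Z2 Y1 Y2 : R) :
    a1 * u1 ^+ 2 + c1 = a1 -> a2 * u2 ^+ 2 + c2 = a2 ->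
    k * expR (- (2^-1 * (a1 * (u1 ^+ 2 * X1 - 2 * u1 * Y1 + Z1) +
                         a2 * (u2 ^+ 2 * X2 - 2 * u2 * Y2 + Z2)))) *
      (k' * expR (- (2^-1 * (c1 * X1 + c2 * X2)))) =
    k * expR (- (2^-1 * (a1 * (u1 ^+ 2 * Z1 - 2 * u1 * Y1 + X1) +
                         a2 * (u2 ^+ 2 * Z2 - 2 * u2 * Y2 + X2)))) *
      (k' * expR (- (2^-1 * (c1 * Z1 + c2 * Z2)))).
  move=> h1 h2; rewrite [LHS]mulrACA [RHS]mulrACA -!expRD; congr (_ * expR _).
  have -> : c1 = a1 - a1 * u1 ^+ 2 by lra.
  have -> : c2 = a2 - a2 * u2 ^+ 2 by lra.
  by ring.
rewrite (pdfE _ (mxact _ x - z) tE) (pdfE _ (mxact _ z - x) tE).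
rewrite (pdfE _ x (ltry _)) (pdfE _ z (ltry _)).
rewrite !(bform_drift _ _ sp1 e1) !(bform_drift _ _ sp2 e2).
rewrite (bformC z x sp1) (bformC z x sp2).
exact: (aux _ _ _ _ _ _ _ _ _ _ _ _ _ _ (bal _ b1_lt0) (bal _ b2_lt0)).
Qed.

End symmetric_semigroup.

Section symmetric_ouR.
Context {R : realType}.
Notation line := (measurableTypeR R).
Notation plane := (line * line)%type.
Variables (B : 'M[R]_2) (b1 b2 : R).
Hypothesis b12 : b1 != b2.
Hypotheses (b1_lt0 : b1 < 0) (b2_lt0 : b2 < 0).
Hypothesis trB : B 0 0 + B 1 1 = b1 + b2.
Hypothesis detB : B 0 0 * B 1 1 - B 0 1 * B 1 0 = b1 * b2.
Hypothesis symB : B^T = B.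
Notation g t := (gamma 1%:M B t).
Notation pdf t := (gauss_pdf 1%:M B t).
Variable t : R.
Hypothesis t_gt0 : 0 < t.
Notation E := (expm (t *: B)).

(* [G f h (x, z)] is the integrand of the pairing of [ouR B t f] with [h], with [z]
   the position at time [t] of the motion started at [x]. *)
Let G (f h : plane -> R) (w : plane * plane) : \bar R :=
  (f w.2 * pdf t%:E (mxact E w.1 - w.2)%R * (h w.1 * pdf +oo w.1))%:E.

Let mG f h : measurable_fun [set: plane] f -> measurable_fun [set: plane] h ->
  measurable_fun [set: plane * plane] (G f h).
Proof.
move=> mf mh; apply/measurable_EFinP; apply: measurable_funM; apply: measurable_funM.
- exact: (measurableT_comp mf measurable_snd).
- exact: (measurableT_comp (measurable_gauss_pdf _ _ _) (measurable_drift E)).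
- exact: (measurableT_comp mh measurable_fst).
- exact: (measurableT_comp (measurable_gauss_pdf _ _ _) measurable_fst).
Qed.

Let G0 f h : (forall x, 0 <= f x) -> (forall x, 0 <= h x) -> forall w, (0 <= G f h w)%E.
Proof.
by move=> f0 h0 w; rewrite lee_fin; apply: mulr_ge0; apply: mulr_ge0 => //; exact: gauss_pdf_ge0.
Qed.

Let pairing_kernel (f h : plane -> R) M :
  measurable_fun [set: plane] f -> measurable_fun [set: plane] h ->
  (forall x, 0 <= f x) -> (forall x, 0 <= h x) -> (forall x, f x <= M) ->
  (\int[g +oo]_x (ouR B t f x * h x)%:E = \int[leb2]_x \int[leb2]_z G f h (x, z))%E.
Proof.
move=> mf mh f0 h0 fM.
have mo := measurable_ouR_ge0 b12 b1_lt0 b2_lt0 trB detB t_gt0 mf f0 fM.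
pose u (x : plane) : \bar R := (ouR B t f x * h x)%:E.
have mu : measurable_fun [set: plane] u.
  by apply/measurable_EFinP; exact: measurable_funM.
have u0 x : (0 <= u x)%E.
  by rewrite lee_fin mulr_ge0//; apply: Rintegral_ge0 => y _.
transitivity (\int[g +oo]_x u x)%E; first reflexivity.
rewrite (ge0_integral_gamma _ _ _ mu u0); apply: eq_integral => x _.
pose k (z : plane) : \bar R := (f z * pdf t%:E (mxact E x - z)%R)%:E.
have mk : measurable_fun [set: plane] k.
  apply/measurable_EFinP; apply: measurable_funM => //.
  exact: (measurableT_comp (measurable_gauss_pdf _ _ _) (measurable_drift1 E x)).
have k0 z : (0 <= k z)%E by rewrite lee_fin mulr_ge0// gauss_pdf_ge0.
have c0 : (0 <= (h x * pdf +oo x)%:E)%E by rewrite lee_fin mulr_ge0// gauss_pdf_ge0.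
transitivity ((h x * pdf +oo x)%:E * \int[leb2]_z k z)%E.
  rewrite -(ouR_ge0E b12 b1_lt0 b2_lt0 trB detB t_gt0 x mf f0 fM) /u -!EFinM.
  congr EFin; move: (ouR B t f x) (h x) (pdf +oo x) => r1 r2 r3; ring.
rewrite -(ge0_integralZl leb2 measurableT mk (fun z _ => k0 z) c0).
by apply: eq_integral => z _; rewrite /k /G -EFinM mulrC.
Qed.

Let ouR_sym_ge0 (f h : plane -> R) M M' :
  measurable_fun [set: plane] f -> measurable_fun [set: plane] h ->
  (forall x, 0 <= f x) -> (forall x, 0 <= h x) ->
  (forall x, f x <= M) -> (forall x, h x <= M') ->
  ip (g +oo) (ouR B t f) h = ip (g +oo) f (ouR B t h).
Proof.
move=> mf mh f0 h0 fM hM'; rewrite [RHS]ipC /ip /Rintegral; congr fine.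
rewrite (pairing_kernel mf mh f0 h0 fM) (pairing_kernel mh mf h0 f0 hM').
transitivity (\int[@leb2_sf R]_x \int[@leb2_sf R]_z G f h (x, z))%E; first reflexivity.
rewrite (fubini_tonelli (G f h) (mG mf mh) (G0 f0 h0)).
apply: eq_integral => z _; apply: eq_integral => x _; rewrite /G /=; congr EFin.
have aux (u v q1 q2 q3 q4 : R) : q1 * q2 = q3 * q4 -> u * q1 * (v * q2) = v * q3 * (u * q4).
  by move=> q; rewrite mulrACA q [RHS]mulrACA (mulrC u).
exact: aux (detailed_balance b12 b1_lt0 b2_lt0 trB detB symB x z t_gt0).
Qed.

(** For nonnegative functions this is [detailed_balance] and Tonelli's theorem. In
    general one adds a common bound [M] to both functions; constants are preserved
    by the semigroup, so the terms with [M] are symmetric as well. *)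
Lemma ouR_sym (f h : plane -> R) (M : R) :
  measurable_fun [set: plane] f -> measurable_fun [set: plane] h ->
  (forall x, `|f x| <= M) -> (forall x, `|h x| <= M) ->
  ip (g +oo) (ouR B t f) h = ip (g +oo) f (ouR B t h).
Proof.
move=> mf mh fM hM.
have M0 : 0 <= M by apply: le_trans (fM 0).
have shift (k : plane -> R) : measurable_fun [set: plane] k -> (forall x, `|k x| <= M) ->
    [/\ measurable_fun [set: plane] (fun x => k x + M), forall x, 0 <= k x + M,
        forall x, k x + M <= M + M &
        [/\ (fun x => k x + M) \in Lfun (g +oo) 2%:E,
         ouR B t (fun x => k x + M) \in Lfun (g +oo) 2%:E &
         ouR B t k = (fun x => ouR B t (fun x => k x + M) x + (- M) * 1)]].
  move=> mk kM.
  have mkM : measurable_fun [set: plane] (fun x => k x + M) by exact: measurable_funD.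
  have ge0 x : 0 <= k x + M by have := kM x; rewrite ler_norml => /andP[]; lra.
  have le x : k x + M <= M + M by have := kM x; rewrite ler_norml => /andP[]; lra.
  have nle x : `|k x + M| <= M + M by rewrite ger0_norm.
  split => //; split.
  - exact: (Lfun2_bounded b12 b1_lt0 b2_lt0 trB detB _ mkM nle).
  - apply: (Lfun2_bounded b12 b1_lt0 b2_lt0 trB detB _ (M := M + M)) => //.
      exact: (measurable_ouR b12 b1_lt0 b2_lt0 trB detB t_gt0 mkM nle).
    by move=> x; exact: (ouR_bound b12 b1_lt0 b2_lt0 trB detB t_gt0 x mkM nle).
  - apply/funext => x.
    have MM y : `|(fun=> M : R) (y : plane)| <= M by rewrite ger0_norm.
    rewrite (ouRD b12 b1_lt0 b2_lt0 trB detB t_gt0 x mk (measurable_cst M) kM MM).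
    by rewrite (ouR_cst b12 b1_lt0 b2_lt0 trB detB t_gt0) mulr1 addrK.
have [mf' f0 fM' [f2 of2 oE]] := shift f mf fM.
have [mh' h0 hM' [h2 oh2 ohE]] := shift h mh hM.
have one2 : (fun=> 1 : R) \in Lfun (g +oo) 2%:E.
  by apply: (Lfun2_bounded b12 b1_lt0 b2_lt0 trB detB _ (M := 1)) => // x; rewrite normr1.
have o1 : ouR B t (fun=> 1) = (fun=> 1 : R).
  by apply/funext => x; rewrite (ouR_cst b12 b1_lt0 b2_lt0 trB detB t_gt0).
have le1 (x : plane) : (1 : R) <= 1 by [].
have ge1 (x : plane) : 0 <= (1 : R) by [].
have S1 := ouR_sym_ge0 mf' mh' f0 h0 fM' hM'.
have S2 := ouR_sym_ge0 mf' (measurable_cst (1 : R)) f0 ge1 fM' le1.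
have S3 := ouR_sym_ge0 (measurable_cst (1 : R)) mh' ge1 h0 le1 hM'.
rewrite o1 in S2 S3.
pose F (x : plane) := f x + M; pose H (x : plane) := h x + M.
have fE : f = (fun x => F x + (- M) * 1) by apply/funext => x; rewrite /F mulr1 addrK.
have hE : h = (fun x => H x + (- M) * 1) by apply/funext => x; rewrite /H mulr1 addrK.
transitivity (ip (g +oo) (fun x => ouR B t F x + (- M) * 1) (fun x => H x + (- M) * 1)).
  by rewrite oE -hE.
transitivity (ip (g +oo) (fun x => F x + (- M) * 1) (fun x => ouR B t H x + (- M) * 1)); last first.
  by rewrite ohE -fE.
have key (u ou v ov one : plane -> R) (c : R) : u \in Lfun (g +oo) 2%:E ->
    ou \in Lfun (g +oo) 2%:E -> v \in Lfun (g +oo) 2%:E -> ov \in Lfun (g +oo) 2%:E ->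
    one \in Lfun (g +oo) 2%:E -> ip (g +oo) ou v = ip (g +oo) u ov ->
    ip (g +oo) ou one = ip (g +oo) u one -> ip (g +oo) one v = ip (g +oo) one ov ->
    ip (g +oo) (fun x => ou x + c * one x) (fun x => v x + c * one x) =
    ip (g +oo) (fun x => u x + c * one x) (fun x => ov x + c * one x).
  move=> u2 ou2 v2 ov2 one2' e1 e2 e3; have c2 := Lfun2Z c one2'.
  by rewrite !ipDl ?Lfun2D// !ipDr// !ipZl// !ipZr// e1 e2 e3.
exact: (key F _ H _ (fun=> 1)).
Qed.

End symmetric_ouR.

(** * The generator for a symmetric drift matrix *)

Lemma cvge0_lt (R : realType) (I : Type) (F : set_system I) (FF : Filter F)
    (u : I -> \bar R) (e : R) :
  u @ F --> 0%E -> 0 < e -> \forall i \near F, (u i < e%:E)%E.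
Proof.
move=> uF e0; apply: (uF [set x | (x < e%:E)%E]).
apply: open_nbhs_nbhs; split; first exact: open_ereal_lt_ereal.
by rewrite /= lte_fin.
Qed.

Section ou_bounded.
Context {R : realType}.
Notation line := (measurableTypeR R).
Notation plane := (line * line)%type.
Variables (B : 'M[R]_2) (b1 b2 : R).
Hypothesis b12 : b1 != b2.
Hypotheses (b1_lt0 : b1 < 0) (b2_lt0 : b2 < 0).
Hypothesis trB : B 0 0 + B 1 1 = b1 + b2.
Hypothesis detB : B 0 0 * B 1 1 - B 0 1 * B 1 0 = b1 * b2.
Notation g t := (gamma 1%:M B t).
Notation goo := (gamma 1%:M B +oo%E).
Implicit Types f h F : R * R -> R[i].

Lemma Re_le_normc (z : R[i]) : `|complex.Re z| <= Normc.normc z.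
Proof. by case: z => a b /=; rewrite -sqrtr_sqr ler_wsqrtr// lerDl sqr_ge0. Qed.

Lemma Im_le_normc (z : R[i]) : `|complex.Im z| <= Normc.normc z.
Proof. by case: z => a b /=; rewrite -sqrtr_sqr ler_wsqrtr// lerDr sqr_ge0. Qed.

Lemma bounded_continuousP F : bounded_continuous F -> exists M : R,
  [/\ measurable_fun [set: plane] (fun x : plane => complex.Re (F x)),
      measurable_fun [set: plane] (fun x : plane => complex.Im (F x)),
      forall x : plane, `|complex.Re (F x)| <= M & forall x : plane, `|complex.Im (F x)| <= M].
Proof.
move=> [cr ci [M FM]]; exists M; split.
- exact: continuous_plane_measurable.
- exact: continuous_plane_measurable.
- by move=> x; rewrite (le_trans (Re_le_normc _)).
- by move=> x; rewrite (le_trans (Im_le_normc _)).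
Qed.

Lemma bounded_continuous_L2 F : bounded_continuous F -> L2 goo F.
Proof.
move=> /bounded_continuousP[M [mr mi rM iM]]; split.
  exact: (Lfun2_bounded b12 b1_lt0 b2_lt0 trB detB _ mr rM).
exact: (Lfun2_bounded b12 b1_lt0 b2_lt0 trB detB _ mi iM).
Qed.

Lemma ou_bc_L2 (t : R) F : 0 < t -> bounded_continuous F -> L2 goo (ou_bc 1%:M B t F).
Proof.
move=> t0 /bounded_continuousP[M [mr mi rM iM]].
have K (k : plane -> R) : measurable_fun [set: plane] k -> (forall x : plane, `|k x| <= M) ->
    ouR B t k \in Lfun goo 2%:E.
  move=> mk kM; apply: (Lfun2_bounded b12 b1_lt0 b2_lt0 trB detB _ (M := M)) => //.
    exact: (measurable_ouR b12 b1_lt0 b2_lt0 trB detB t0 mk kM).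
  by move=> x; exact: (ouR_bound b12 b1_lt0 b2_lt0 trB detB t0 x mk kM).
by split; [exact: (K _ mr rM)|exact: (K _ mi iM)].
Qed.

Hypothesis symB : B^T = B.

Lemma ou_bc_sym (t : R) F F' : 0 < t -> bounded_continuous F -> bounded_continuous F' ->
  L2dot goo (ou_bc 1%:M B t F) F' = L2dot goo F (ou_bc 1%:M B t F').
Proof.
move=> t0 bF bF'.
rewrite (L2dotE (ou_bc_L2 t0 bF) (bounded_continuous_L2 bF')).
rewrite (L2dotE (bounded_continuous_L2 bF) (ou_bc_L2 t0 bF')).
have [M [mr mi rM iM]] := bounded_continuousP bF.
have [M' [mr' mi' rM' iM']] := bounded_continuousP bF'.
have S (k k' : plane -> R) : measurable_fun [set: plane] k -> measurable_fun [set: plane] k' ->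
    (forall x, `|k x| <= M) -> (forall x, `|k' x| <= M') ->
    ip goo (ouR B t k) k' = ip goo k (ouR B t k').
  move=> mk mk' kM kM'.
  apply: (ouR_sym b12 b1_lt0 b2_lt0 trB detB symB t0 (M := Num.max M M')) => // x.
    by rewrite le_max kM.
  by rewrite le_max kM' orbT.
congr Complex.
  by congr (_ + _); [exact: (S _ _ mr mr' rM rM')|exact: (S _ _ mi mi' iM iM')].
by congr (_ - _); [exact: (S _ _ mi mr' iM rM')|exact: (S _ _ mr mi' rM iM')].
Qed.

(** Approximants of the two functions are taken at the same index. *)
Lemma ou_sym (t : R) f g f' g' : 0 < t -> ou 1%:M B t f g -> ou 1%:M B t f' g' ->
  L2dot goo g f' = L2dot goo f g'.
Proof.
move=> t0 [f2 g2 [F [bF cF cG]]] [f'2 g'2 [F' [bF' cF' cG']]].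
apply: L2dot_approx => // e e0.
have [n [[n1 n2] [n3 n4]]] : exists n,
    ((L2norm goo (fun x => ou_bc 1%:M B t (F n) x - g x)%R < e%:E)%E /\
    (L2norm goo (fun x => F' n x - f' x)%R < e%:E)%E) /\
    ((L2norm goo (fun x => F n x - f x)%R < e%:E)%E /\
    (L2norm goo (fun x => ou_bc 1%:M B t (F' n) x - g' x)%R < e%:E)%E).
  have N := filterI (filterI (cvge0_lt _ cG e0) (cvge0_lt _ cF' e0))
                    (filterI (cvge0_lt _ cF e0) (cvge0_lt _ cG' e0)).
  by have [n _ hn] := N; exists n; exact: (hn n (leqnn n)).
exists (ou_bc 1%:M B t (F n)), (F' n), (F n), (ou_bc 1%:M B t (F' n)); split=> //.
  by split; [exact: ou_bc_L2|exact: bounded_continuous_L2|exact: bounded_continuous_L2|exact: ou_bc_L2].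
exact: ou_bc_sym.
Qed.

Lemma ou_gen_sym f g f' g' : ou_gen 1%:M B f g -> ou_gen 1%:M B f' g' ->
  L2dot goo g f' = L2dot goo f g'.
Proof.
move=> [f2 g2 [H [oH cH]]] [f'2 g'2 [H' [oH' cH']]].
apply: L2dot_approx => // e e0.
have FF : Filter (0:R)^'+ by exact: at_right_proper_filter.
have [t [t0 [tH tH']]] : exists t : R, 0 < t /\
    ((L2norm goo (fun x => (t^-1)%:C * (H t x - f x) - g x)%R < e%:E)%E /\
    (L2norm goo (fun x => (t^-1)%:C * (H' t x - f' x) - g' x)%R < e%:E)%E).
  apply: (@filter_ex _ (0:R)^'+).
  apply: filterI; first exact: nbhs_right_gt.
  by apply: filterI; [exact: (cvge0_lt _ cH e0)|exact: (cvge0_lt _ cH' e0)].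
have Ht2 : L2 goo (H t) by case: (oH t t0).
have H't2 : L2 goo (H' t) by case: (oH' t t0).
exists (fun x => (t^-1)%:C * (H t x - f x)), f', f, (fun x => (t^-1)%:C * (H' t x - f' x)).
have zero h : L2 goo h -> (L2norm goo (fun x => h x - h x)%R < e%:E)%E.
  move=> h2; rewrite (L2normE (L2B h2 h2)) lte_fin.
  have := L2dotxx (L2B h2 h2); rewrite (L2dotBl h2 h2 (L2B h2 h2)) subrr => -[<-].
  by rewrite sqrtr0.
split=> //.
- by split => //; apply: L2Z; apply: L2B.
- by split=> //; exact: zero.
- by split=> //; exact: zero.
rewrite (L2dotZl _ (L2B Ht2 f2) f'2) (L2dotZr _ (L2B H't2 f'2) f2).
rewrite (L2dotBl Ht2 f2 f'2) (L2dotBr H't2 f'2 f2).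
rewrite (ou_sym t0 (oH t t0) (oH' t t0)); congr (_ * _).
by apply: eq_complexP; rewrite ?ReJ ?ImJ /= ?oppr0.
Qed.


(** If [v = (L - mu) u] were a nonzero eigenvector for [mu], then
    [<v, v> = <(L - mu) u, v> = <u, (L - mu) v> = 0]; so a chain of generalized
    eigenvectors has length one. The eigenvalue is real because
    [<L u, u> = <u, L u>]. *)
Lemma symmetric_gen_eigenfunction (mu : R[i]) k u : L2 goo u ->
  ~ L2eq goo u (fun=> 0) -> ou_pow 1%:M B mu k u (fun=> 0) ->
  (mu^*)%C = mu /\ exists w, ou_gen 1%:M B u w /\ L2eq goo w (fun x => mu * u x).
Proof.
elim: k u => [|k IH] u u2 u0; first by move=> /u0.
case=> w Lu pv.
have w2 : L2 goo w by case: Lu.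
have mu2 := L2Z mu u2; have v2 := L2B w2 mu2.
have [v0|v0] := pselect (L2eq goo (fun x => w x - mu * u x) (fun=> 0)).
  have wE : L2eq goo w (fun x => mu * u x).
    by apply: filterS v0 => x /= /eqP; rewrite subr_eq0 => /eqP.
  split; last by exists w.
  have uu0 : L2dot goo u u != 0 by apply/eqP => /(L2dot_eq0 u2).
  apply: (mulIf uu0); rewrite -(L2dotZr _ u2 u2) -(L2eq_dotr w2 mu2 u2 wE).
  by rewrite -(ou_gen_sym Lu Lu) (L2eq_dotl w2 mu2 u2 wE) L2dotZl.
have [muR [w' [Lv w'E]]] := IH _ v2 v0 pv.
have w'2 : L2 goo w' by case: Lv.
exfalso; apply: v0; apply: L2dot_eq0 => //.
rewrite [LHS](L2dotBl w2 mu2 v2) (ou_gen_sym Lu Lv).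
by rewrite (L2eq_dotr w'2 (L2Z mu v2) u2 w'E) (L2dotZr _ v2 u2) (L2dotZl _ u2 v2) muR subrr.
Qed.

Lemma symmetric_gen_eigenspaces_orthogonal (mu nu : R[i]) : mu != nu ->
  forall u v, gen_eigenspace 1%:M B mu u -> gen_eigenspace 1%:M B nu v ->
  L2dot goo u v = 0.
Proof.
move=> munu.
have base u v : gen_eigenfunction 1%:M B mu u -> gen_eigenfunction 1%:M B nu v ->
    L2dot goo u v = 0.
  move=> [u2 u0 [k _ pu]] [v2 v0 [m _ pv]].
  have [_ [w [Lu wE]]] := symmetric_gen_eigenfunction u2 u0 pu.
  have [nuR [z [Lv zE]]] := symmetric_gen_eigenfunction v2 v0 pv.
  have w2 : L2 goo w by case: Lu.
  have z2 : L2 goo z by case: Lv.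
  have := ou_gen_sym Lu Lv.
  rewrite (L2eq_dotl w2 (L2Z mu u2) v2 wE) (L2eq_dotr z2 (L2Z nu v2) u2 zE).
  rewrite (L2dotZl _ u2 v2) (L2dotZr _ v2 u2) nuR => /eqP.
  by rewrite -subr_eq0 -mulrBl mulf_eq0 subr_eq0 (negbTE munu) => /eqP.
move=> u v [u2 [n [c [e [eE uE]]]]] [v2 [m [c' [e' [e'E vE]]]]].
have e2 i : L2 goo (e i) by case: (eE i).
have e'2 i : L2 goo (e' i) by case: (e'E i).
rewrite (L2eq_dotl u2 (L2_sum c e2) v2 uE) (L2eq_dotr v2 (L2_sum c' e'2) (L2_sum c e2) vE).
apply: L2dot_suml => //; first exact: L2_sum.
move=> i; rewrite (L2dotC (L2_sum c' e'2) (e2 i)).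
rewrite L2dot_suml ?rmorph0// => j.
by rewrite (L2dotC (e2 i) (e'2 j)) (base _ _ (eE i) (e'E j)) rmorph0.
Qed.

End ou_bounded.

(** * Linear forms as eigenfunctions of the generator *)

Section truncation.
Context {R : realType}.

(** A smooth truncation at height [n + 1], whose error is quadratic in the
    argument. *)
Definition trunc (n : nat) (r : R) : R := r / (1 + (r / n.+1%:R) ^+ 2).

Lemma trunc_den_gt0 (s : R) : 0 < 1 + s ^+ 2.
Proof. by rewrite ltr_pwDl ?sqr_ge0. Qed.

Lemma norm_ratio_le1 (s : R) : `|s| / (1 + s ^+ 2) <= 1.
Proof.
rewrite ler_pdivrMr ?trunc_den_gt0// mul1r ler_norml.
by apply/andP; split; nra.
Qed.

Lemma trunc_bound n r : `|trunc n r| <= n.+1%:R.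
Proof.
rewrite /trunc; set N : R := n.+1%:R; have N0 : 0 < N by rewrite ltr0n.
have := norm_ratio_le1 (r / N); rewrite normrM normfV (gtr0_norm N0) => h.
rewrite normrM normfV (gtr0_norm (trunc_den_gt0 _)).
have -> : `|r| / (1 + (r / N) ^+ 2) = N * (`|r| / N / (1 + (r / N) ^+ 2)).
  rewrite (mulrA N) (mulrA N) (mulrC N `|r|) mulfK// gt_eqF//.
by rewrite -[leRHS]mulr1 ler_pM2l.
Qed.

(** With [s = r / (n + 1)] the error is [(n + 1) s^2 * (s / (1 + s^2))], and the last
    factor is at most [1]. *)
Lemma trunc_err n r : `|trunc n r - r| <= n.+1%:R^-1 * r ^+ 2.
Proof.
rewrite /trunc; set N : R := n.+1%:R; have N0 : 0 < N by rewrite ltr0n.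
have s0 := trunc_den_gt0 (r / N).
have -> : r / (1 + (r / N) ^+ 2) - r = - (N^-1 * r ^+ 2 * ((r / N) / (1 + (r / N) ^+ 2))).
  have aux (M s : R) : M != 0 -> 1 + s ^+ 2 != 0 ->
      M * s / (1 + s ^+ 2) - M * s = - (M^-1 * (M * s) ^+ 2 * (s / (1 + s ^+ 2))).
    by move=> M0 s1; field; rewrite M0 s1.
  have := aux N (r / N) (lt0r_neq0 N0) (lt0r_neq0 s0).
  by rewrite (mulrC N (r / N)) divfK ?gt_eqF.
have n0 : 0 <= N^-1 * r ^+ 2.
  by apply: mulr_ge0; [rewrite invr_ge0 ltW|exact: sqr_ge0].
rewrite normrN normrM (ger0_norm n0) normrM normfV (gtr0_norm s0).
by rewrite ler_piMr// norm_ratio_le1.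
Qed.

Lemma continuous_trunc n : continuous (trunc n).
Proof.
move=> r; apply: cvgM; first exact: cvg_id.
apply: cvgV; first by rewrite gt_eqF// trunc_den_gt0.
apply: cvgD; first exact: cvg_cst.
rewrite expr2; under eq_fun do rewrite expr2.
by apply: cvgM; apply: cvgMr_tmp; exact: cvg_id.
Qed.

Lemma continuous_lform (u : R * R) : continuous (lform u).
Proof.
move=> x; apply: cvgD; apply: cvgMl_tmp; [exact: cvg_fst|exact: cvg_snd].
Qed.

(** With [y = t b < 0], the bounds [1 + y <= e^y <= 1 / (1 - y)] give
    [0 <= e^y - 1 - y <= y^2]. *)
Lemma expRM_taylor (b t : R) : b < 0 -> 0 < t ->
  `|t^-1 * (expR (t * b) - 1) - b| <= t * b ^+ 2.
Proof.
move=> b0 t0; set y := t * b.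
have y0 : y < 0 by rewrite nmulr_llt0.
have l := expR_ge1Dx y.
have h : expR y * (1 - y) <= 1.
  have := expR_ge1Dx (- y); rewrite expRN => h.
  have e0 := expR_gt0 y.
  by rewrite -(ler_pdivlMl _ _ e0) mulr1.
have -> : t^-1 * (expR y - 1) - b = t^-1 * (expR y - 1 - y).
  by rewrite /y; field; rewrite gt_eqF.
have -> : t * b ^+ 2 = t^-1 * y ^+ 2 by rewrite /y; field; rewrite gt_eqF.
rewrite normrM ger0_norm ?invr_ge0 ?(ltW t0)// ler_pM2l ?invr_gt0//.
by rewrite ger0_norm; [have := expR_gt0 y; nra|lra].
Qed.

End truncation.

Lemma cvge0_squeeze (R : realType) (I : Type) (F : set_system I) (FF : Filter F)
    (u : I -> \bar R) (v : I -> R) :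
  (\forall i \near F, (0 <= u i <= (v i)%:E)%E) -> v @ F --> (0 : R) -> u @ F --> 0%E.
Proof.
move=> uv v0; apply: (@squeeze_cvge _ _ _ _ (cst 0%E) _ (EFin \o v)) => //.
  exact: cvg_cst.
by apply/cvg_EFin; [exact: nearW|].
Qed.

(** Only [b1] enters the conclusions, so the results apply to [b2] by exchanging the
    two eigenvalues. *)
Section linear_eigenfunctions.
Context {R : realType}.
Notation line := (measurableTypeR R).
Notation plane := (line * line)%type.
Variables (B : 'M[R]_2) (b1 b2 : R).
Hypothesis b12 : b1 != b2.
Hypotheses (b1_lt0 : b1 < 0) (b2_lt0 : b2 < 0).
Hypothesis trB : B 0 0 + B 1 1 = b1 + b2.
Hypothesis detB : B 0 0 * B 1 1 - B 0 1 * B 1 0 = b1 * b2.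
Notation g t := (gamma 1%:M B t).
Notation goo := (gamma 1%:M B +oo%E).
Variable u : R * R.
Hypothesis uB : (colv u)^T *m B = b1 *: (colv u)^T.
Notation l := (lform u).
Notation lC := (fun x : R * R => (lform u x)%:C).

Lemma lformB x y : l (x - y) = l x - l y.
Proof. by rewrite /lform /=; ring. Qed.

Lemma lform_colv x : l x = ((colv u)^T *m colv x) 0 0.
Proof. by rewrite mul2E !mxE. Qed.

(** [u] is fixed by the first spectral projection and annihilated by the second. *)
Lemma lform_expm t x : l (mxact (expm (t *: B)) x) = expR (t * b1) * l x.
Proof.
have up1 : (colv u)^T *m specproj B b1 b2 = (colv u)^T.
  rewrite /specproj -scalemxAr mulmxBr uB mul_mx_scalar -scalerBl scalerA.
  by rewrite mulVf ?scale1r// subr_eq0.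
have up2 : (colv u)^T *m specproj B b2 b1 = 0.
  by rewrite /specproj -scalemxAr mulmxBr uB mul_mx_scalar subrr scaler0.
rewrite !lform_colv colv_mxact mulmxA (expm_spectral b12 trB detB).
move: up1 up2; move: (specproj B b1 b2) (specproj B b2 b1) => p1 p2 up1 up2.
by rewrite mulmxDr -!scalemxAr up1 up2 scaler0 addr0 -scalemxAl mxE.
Qed.

Section at_time.
Variable s : \bar R.
Hypothesis s_gt0 : (0 < s)%E.
Let pd := Qmx_posdef b12 b1_lt0 b2_lt0 trB detB s_gt0.

Lemma Lfun2_eigenform : l \in Lfun (g s) 2%:E.
Proof. by case: pd => h1 h2 h3; exact: Lfun2_lform. Qed.

Lemma Lfun2_eigenform_sqr : (fun x => l x ^+ 2) \in Lfun (g s) 2%:E.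
Proof. by case: pd => h1 h2 h3; exact: Lfun2_lform_sqr. Qed.

Lemma Rintegral_eigenform : \int[g s]_x l x = 0.
Proof. by case: pd => h1 h2 h3; exact: Rintegral_lform. Qed.

Lemma Rintegral_eigenform_sub (c : R) : \int[g s]_x (c - l x) = c.
Proof.
rewrite RintegralB//.
- by rewrite (Rintegral_gamma_cst b12 b1_lt0 b2_lt0 trB detB s_gt0) Rintegral_eigenform subr0.
- apply: (Lfun2_integrable b12 b1_lt0 b2_lt0 trB detB s_gt0).
  exact: (Lfun2_bounded b12 b1_lt0 b2_lt0 trB detB s_gt0 (M := `|c|)).
- exact: (Lfun2_integrable b12 b1_lt0 b2_lt0 trB detB s_gt0 Lfun2_eigenform).
Qed.

Lemma Rintegral_eigenform_sub_sqr (c : R) :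
  (g s).-integrable setT (EFin \o (fun x : plane => (c - l x) ^+ 2)) /\
  \int[g s]_x ((c - l x) ^+ 2) = c ^+ 2 + ip (g s) l l.
Proof.
have L k := Lfun2_integrable b12 b1_lt0 b2_lt0 trB detB s_gt0 (h := k).
have c2 : (fun=> c ^+ 2 : R) \in Lfun (g s) 2%:E.
  exact: (Lfun2_bounded b12 b1_lt0 b2_lt0 trB detB s_gt0 (M := `|c ^+ 2|)).
have m2 := Lfun2Z (- (2 * c)) Lfun2_eigenform.
have E : (fun x => (c - l x) ^+ 2) = (fun x => c ^+ 2 + (- (2 * c)) * l x + l x ^+ 2).
  by apply/funext => x; ring.
rewrite E; split; first exact: (L _ (Lfun2D (Lfun2D c2 m2) Lfun2_eigenform_sqr)).
rewrite RintegralD//; [|exact: (L _ (Lfun2D c2 m2))|exact: (L _ Lfun2_eigenform_sqr)].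
rewrite RintegralD//; [|exact: (L _ c2)|exact: (L _ m2)].
rewrite (RintegralZl _ measurableT (L _ Lfun2_eigenform)).
rewrite Rintegral_eigenform mulr0 addr0 (Rintegral_gamma_cst b12 b1_lt0 b2_lt0 trB detB s_gt0).
by congr (_ + _); apply: eq_Rintegral => x _; rewrite expr2.
Qed.

End at_time.

Lemma L2_real (h : plane -> R) : h \in Lfun goo 2%:E -> L2 goo (fun x => (h x)%:C).
Proof.
move=> h2; split => //=.
by apply: (Lfun2_bounded b12 b1_lt0 b2_lt0 trB detB _ (M := 0)) => // x; rewrite normr0.
Qed.

Lemma sqn_real (h : plane -> R) : sqn goo (fun x => (h x)%:C) = ip goo h h.
Proof.
rewrite /sqn /= [X in _ + X](_ : _ = 0) ?addr0//.
by rewrite /ip; under eq_Rintegral do rewrite mulr0; exact: (Rintegral_gamma_cst b12 b1_lt0 b2_lt0 trB detB).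
Qed.

Lemma L2norm_real_le (h k : plane -> R) (c : R) : h \in Lfun goo 2%:E ->
  k \in Lfun goo 2%:E -> 0 <= c -> (forall x, `|h x| <= c * `|k x|) ->
  (L2norm goo (fun x => (h x)%:C) <= (c * Num.sqrt (ip goo k k))%:E)%E.
Proof.
move=> h2 k2 c0 hk; rewrite (L2normE (L2_real h2)) lee_fin sqn_real.
have ck2 := Lfun2Z c k2.
have -> : c * Num.sqrt (ip goo k k) = Num.sqrt (ip goo (fun x => c * k x) (fun x => c * k x)).
  by rewrite ipZl// ipZr// mulrA -expr2 sqrtrM ?sqr_ge0// sqrtr_sqr ger0_norm.
rewrite ler_wsqrtr//; apply: le_Rintegral => //.
- exact: (Lfun2_integrableM h2 h2).
- exact: (Lfun2_integrableM ck2 ck2).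
move=> x _; rewrite -!expr2 -(real_normK (num_real (h x))) -(real_normK (num_real (c * k x))).
by rewrite lerXn2r// ?nnegrE// normrM (ger0_norm c0).
Qed.

Let F n (x : R * R) : R[i] := (trunc n (l x))%:C.

Lemma trunc_bounded_continuous n : bounded_continuous (F n).
Proof.
split => /=.
- move=> x; apply: continuous_comp; [exact: continuous_lform|exact: continuous_trunc].
- by move=> x; exact: cvg_cst.
- exists n.+1%:R => x; rewrite /= expr0n addr0 sqrtr_sqr; exact: trunc_bound.
Qed.

(** [e^(t b1) l x] is the integral of [l (e^(tB) x - y)], because [l] has mean zero;
    the error of the truncation is then integrated. *)
Lemma ouR_trunc_err n (t : R) x : 0 < t ->
  `|ouR B t (fun y => trunc n (l y)) x - expR (t * b1) * l x| <=
  n.+1%:R^-1 * ((expR (t * b1) * l x) ^+ 2 + ip (g t%:E) l l).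
Proof.
move=> t0; have tE : (0 < t%:E)%E by rewrite lte_fin.
set c := expR (t * b1) * l x.
have mtr : measurable_fun [set: plane] (fun y : plane => trunc n (l y)).
  by apply: continuous_plane_measurable; have [] := trunc_bounded_continuous n.
have bnd (y : plane) : `|trunc n (l y)| <= n.+1%:R by exact: trunc_bound.
have itr := ouR_integrable b12 b1_lt0 b2_lt0 trB detB t0 x mtr bnd.
have il : (g t%:E).-integrable setT (EFin \o (fun y : plane => c - l y)).
  apply: (Lfun2_integrable b12 b1_lt0 b2_lt0 trB detB tE).
  have c2 : (fun=> c : R) \in Lfun (g t%:E) 2%:E.
    exact: (Lfun2_bounded b12 b1_lt0 b2_lt0 trB detB tE (M := `|c|)).
  have -> : (fun y : plane => c - l y) = (fun y => c + -1 * l y).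
    by apply/funext => y; rewrite mulN1r.
  exact: (Lfun2D c2 (Lfun2Z (-1) (Lfun2_eigenform tE))).
have [isq sqE] := Rintegral_eigenform_sub_sqr tE c.
rewrite -{1}(Rintegral_eigenform_sub tE c) /ouR -RintegralB//.
have idiff : (g t%:E).-integrable setT (EFin \o (fun y : plane =>
    trunc n (l (mxact (expm (t *: B)) x - y)) - (c - l y))).
  exact: (integrableB measurableT itr il).
apply: le_trans (le_normr_Rintegral measurableT idiff) _.
rewrite -sqE -RintegralZl//; apply: le_Rintegral => //.
- exact: integrable_norm.
- exact: (integrableZl measurableT _ isq).
- by move=> y _; rewrite lformB lform_expm; exact: trunc_err.
Qed.

(** The truncations of [l] approximate it with an error at most [l^2 / (n + 1)], and
    their images approximate [e^(t b1) l] with an error at most [w / (n + 1)],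
    where [w] is square integrable. *)
Lemma ou_lform (t : R) : 0 < t -> ou 1%:M B t lC (fun x => (expR (t * b1) * l x)%:C).
Proof.
move=> t0; have tE : (0 < t%:E)%E by rewrite lte_fin.
have ooE : (0 < +oo :> \bar R)%E by rewrite ltry.
have l2 := Lfun2_eigenform ooE; have lsq2 := Lfun2_eigenform_sqr ooE.
split; [exact: L2_real|exact/L2_real/Lfun2Z|].
have tb n (y : plane) : `|trunc n (l y)| <= n.+1%:R by exact: trunc_bound.
have mtr n : measurable_fun [set: plane] (fun y : plane => trunc n (l y)).
  by apply: continuous_plane_measurable; have [] := trunc_bounded_continuous n.
have minusl (c : R) (h : plane -> R) : h \in Lfun goo 2%:E ->
    (fun y => h y - c * l y) \in Lfun goo 2%:E.
  move=> h2; have -> : (fun y => h y - c * l y) = (fun y => h y + - c * l y).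
    by apply/funext => y; rewrite mulNr.
  exact: (Lfun2D h2 (Lfun2Z (- c) l2)).
have vanish (K : R) : (fun n : nat => n.+1%:R^-1 * K) @ \oo --> (0 : R).
  by rewrite -[X in _ --> X](mul0r K); apply: cvgMr_tmp; exact: cvg_harmonic.
exists F; split; first exact: trunc_bounded_continuous.
  have FE n : (fun x => F n x - lC x) = (fun x => (trunc n (l x) - 1 * l x)%:C).
    by apply/funext => x; apply: eq_complexP; rewrite ?ReD ?ReN ?ImD ?ImN /= ?subr0 ?mul1r.
  pose K := Num.sqrt (ip goo (fun x => l x ^+ 2) (fun x => l x ^+ 2)).
  apply: (cvge0_squeeze _ _ (vanish K)); apply: nearW => n; rewrite Lnorm_ge0 FE /=.
  apply: L2norm_real_le => //.
  - by apply: minusl; exact: (Lfun2_bounded b12 b1_lt0 b2_lt0 trB detB ooE (mtr n) (tb n)).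
  - by move=> x; rewrite (ger0_norm (sqr_ge0 _)) mul1r; exact: trunc_err.
set e := expR (t * b1).
have GE n : (fun x => ou_bc 1%:M B t (F n) x - (e * l x)%:C) =
    (fun x => (ouR B t (fun y => trunc n (l y)) x - e * l x)%:C).
  apply/funext => x; apply: eq_complexP; rewrite ?ReD ?ReN ?ImD ?ImN //= subr0.
  exact: (Rintegral_gamma_cst b12 b1_lt0 b2_lt0 trB detB tE 0).
pose w (x : plane) : R := e ^+ 2 * l x ^+ 2 + ip (g t%:E) l l.
have w2 : w \in Lfun goo 2%:E.
  apply: Lfun2D; first exact: Lfun2Z.
  exact: (Lfun2_bounded b12 b1_lt0 b2_lt0 trB detB ooE (M := `|ip (g t%:E) l l|)).
apply: (cvge0_squeeze _ _ (vanish (Num.sqrt (ip goo w w)))).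
apply: nearW => n; rewrite Lnorm_ge0 GE /=; apply: L2norm_real_le => //.
- apply: minusl; apply: (Lfun2_bounded b12 b1_lt0 b2_lt0 trB detB ooE (M := n.+1%:R)).
    exact: (measurable_ouR b12 b1_lt0 b2_lt0 trB detB t0 (mtr n) (tb n)).
  by move=> x; exact: (ouR_bound b12 b1_lt0 b2_lt0 trB detB t0 x (mtr n) (tb n)).
- move=> x; apply: le_trans (ouR_trunc_err n x t0) _.
  by rewrite -/e exprMn ler_wpM2l// ler_norm.
Qed.

Lemma ou_gen_lform : ou_gen 1%:M B lC (fun x => (b1 * l x)%:C).
Proof.
have ooE : (0 < +oo :> \bar R)%E by rewrite ltry.
have l2 := Lfun2_eigenform ooE.
split; [exact: L2_real|exact/L2_real/Lfun2Z|].
exists (fun t x => (expR (t * b1) * l x)%:C); split; first exact: ou_lform.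
have HE (t : R) : (fun x => (t^-1)%:C * ((expR (t * b1) * l x)%:C - lC x) - (b1 * l x)%:C) =
    (fun x => ((t^-1 * (expR (t * b1) - 1) - b1) * l x)%:C).
  apply/funext => x; apply: eq_complexP.
    by rewrite ReD ReM ReN !ReD !ImD !ReN /= mul0r subr0; ring.
  by rewrite ImD ImM ImN !ReD !ImD !ImN /= ?(mul0r,subr0,mulr0,addr0).
pose K := b1 ^+ 2 * Num.sqrt (ip goo l l).
apply: (@cvge0_squeeze _ _ _ _ _ (fun t => t * K)).
  apply: filterS (nbhs_right_gt 0) => t t0; rewrite HE Lnorm_ge0 /= /K mulrA.
  apply: L2norm_real_le => //; first exact: Lfun2Z.
    by rewrite mulr_ge0 ?sqr_ge0// ltW.
  by move=> x; rewrite normrM ler_wpM2r//; exact: expRM_taylor.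
rewrite -[X in _ --> X](mul0r K); apply: cvgMr_tmp.
by apply: cvg_at_right_filter; exact: cvg_id.
Qed.

Lemma gen_eigenfunction_lform : ~ L2eq goo lC (fun=> 0) ->
  gen_eigenfunction 1%:M B b1%:C lC.
Proof.
move=> n0; split => //; first by apply: L2_real; apply: Lfun2_eigenform; rewrite ltry.
exists 1%N => //=; exists (fun x => (b1 * l x)%:C); first exact: ou_gen_lform.
by apply: nearW => x; rewrite rmorphM subrr.
Qed.

Lemma gen_eigenspace_lform : ~ L2eq goo lC (fun=> 0) ->
  gen_eigenspace 1%:M B b1%:C lC.
Proof.
move=> n0; have eg := gen_eigenfunction_lform n0.
split; first by case: eg.
exists 1%N, (fun=> 1), (fun=> lC); split => //.
by apply: nearW => x; rewrite big_ord_recl big_ord0 addr0 mul1r.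
Qed.

End linear_eigenfunctions.

(** * Orthogonality of the eigenspaces of the drift matrix *)

Section eigenvectors.
Context {R : realType}.
Variables (B : 'M[R]_2) (b1 b2 : R).
Hypothesis b12 : b1 != b2.
Hypothesis trB : B 0 0 + B 1 1 = b1 + b2.
Variables a1 a2 : R * R.
Hypotheses (a1_neq0 : a1 != 0) (a2_neq0 : a2 != 0).
Hypothesis a1B : (colv a1)^T *m B = b1 *: (colv a1)^T.
Hypothesis a2B : (colv a2)^T *m B = b2 *: (colv a2)^T.

Let entries (a : R * R) b : (colv a)^T *m B = b *: (colv a)^T ->
  a.1 * B 0 0 + a.2 * B 1 0 = b * a.1 /\ a.1 * B 0 1 + a.2 * B 1 1 = b * a.2.
Proof. by move/rowP => h; move: (h 0) (h 1); rewrite !mul2E !mxE. Qed.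

Let normsq_gt0 (a : R * R) : a != 0 -> 0 < a.1 ^+ 2 + a.2 ^+ 2.
Proof.
move=> a0; rewrite lt_def addr_ge0 ?sqr_ge0// andbT.
apply: contra a0; rewrite paddr_eq0 ?sqr_ge0// !sqrf_eq0 => /andP[/eqP h1 /eqP h2].
by apply/eqP; case: a h1 h2 => x y /= -> ->.
Qed.

(** In the plane the eigenvectors of [B] are the eigenvectors of its transpose
    turned by a right angle, with the eigenvalues exchanged. *)
Lemma orthogonal_eigenspacesP : orthogonal_eigenspaces B b1 b2 <-> dotp a1 a2 = 0.
Proof.
have [e1 e1'] := entries a1B; have [e2 e2'] := entries a2B.
split => [h|a12].
  pose u : 'rV[R]_2 := \row_j (if j == 0 then - a2.2 else a2.1).
  pose v : 'rV[R]_2 := \row_j (if j == 0 then - a1.2 else a1.1).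
  have /rowP/(_ 0) : u *m v^T = 0.
    apply: h; apply/eigenspaceP; apply/rowP; apply: ord2P;
      rewrite mul2E !mxE /=; have b11 : B 1 1 = b1 + b2 - B 0 0 by (rewrite -trB; ring).
    - by move: e2 e2'; rewrite b11; lra.
    - by move: e2 e2'; rewrite b11; lra.
    - by move: e1 e1'; rewrite b11; lra.
    - by move: e1 e1'; rewrite b11; lra.
  by rewrite mul2E !mxE /= /dotp mulrNN addrC (mulrC a2.1) (mulrC a2.2).
move=> u v /eigenspaceP uE /eigenspaceP vE.
move/rowP: uE => uE; move: (uE 0) (uE 1); rewrite !mul2E !mxE => u0 u1.
move/rowP: vE => vE; move: (vE 0) (vE 1); rewrite !mul2E !mxE => v0 v1.
have d12 : b1 - b2 != 0 by rewrite subr_eq0.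
have a1v : a1.1 * v 0 0 + a1.2 * v 0 1 = 0.
  apply: (mulfI d12); rewrite mulr0 mulrBl.
  have -> : b1 * (a1.1 * v 0 0 + a1.2 * v 0 1) = (b1 * a1.1) * v 0 0 + (b1 * a1.2) * v 0 1 by ring.
  have -> : b2 * (a1.1 * v 0 0 + a1.2 * v 0 1) = a1.1 * (b2 * v 0 0) + a1.2 * (b2 * v 0 1) by ring.
  by rewrite -e1 -e1' -v0 -v1; ring.
have a2u : a2.1 * u 0 0 + a2.2 * u 0 1 = 0.
  apply: (mulfI d12); rewrite mulr0 mulrBl.
  have -> : b1 * (a2.1 * u 0 0 + a2.2 * u 0 1) = a2.1 * (b1 * u 0 0) + a2.2 * (b1 * u 0 1) by ring.
  have -> : b2 * (a2.1 * u 0 0 + a2.2 * u 0 1) = (b2 * a2.1) * u 0 0 + (b2 * a2.2) * u 0 1 by ring.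
  by rewrite -e2 -e2' -u0 -u1; ring.
move: a12 (normsq_gt0 a1_neq0) (normsq_gt0 a2_neq0) a1v a2u; rewrite /dotp.
have aux (p q r s x y z w : R) : p * r + q * s = 0 -> 0 < p ^+ 2 + q ^+ 2 ->
    0 < r ^+ 2 + s ^+ 2 -> p * z + q * w = 0 -> r * x + s * y = 0 -> x * z + y * w = 0.
  move=> prqs n1 n2 pz rx.
  have c : p * y - q * x = 0.
    apply: (mulfI (lt0r_neq0 n2)); rewrite mulr0.
    transitivity (r * (y * (p * r + q * s) - q * (r * x + s * y)) +
                  s * (p * (r * x + s * y) - x * (p * r + q * s))); first by ring.
    by rewrite prqs rx; ring.
  apply: (mulfI (lt0r_neq0 n1)); rewrite mulr0.
  transitivity (p * x * (p * z + q * w) + q * y * (p * z + q * w) +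
                (p * w - q * z) * (p * y - q * x)); first by ring.
  by rewrite pz c; ring.
move=> d n1 n2 pz rx; apply/rowP => j.
by rewrite (ord1 j) mul2E !mxE; exact: (aux _ _ _ _ _ _ _ _ d n1 n2 pz rx).
Qed.

(** The second eigenvector is then a multiple of the first one turned by a right
    angle, and a combination of the four scalar eigenvector equations isolates
    [B 1 0 - B 0 1]. *)
Lemma orthogonal_symmetric : dotp a1 a2 = 0 -> B^T = B.
Proof.
have [e1 e1'] := entries a1B; have [e2 e2'] := entries a2B.
rewrite /dotp => a12.
have n1 := normsq_gt0 a1_neq0; have n2 := normsq_gt0 a2_neq0.
suff s : B 1 0 = B 0 1 by apply: mx2P; apply: ord2P; rewrite mxE ?s.
have aux (p q r s x y z w : R) : p * r + q * s = 0 -> 0 < p ^+ 2 + q ^+ 2 ->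
    0 < r ^+ 2 + s ^+ 2 -> p * x + q * z = b1 * p -> p * y + q * w = b1 * q ->
    r * x + s * z = b2 * r -> r * y + s * w = b2 * s -> z = y.
  move=> prqs m1 m2 h1 h2 h3 h4.
  have D2 : (p * s - q * r) ^+ 2 = (p ^+ 2 + q ^+ 2) * (r ^+ 2 + s ^+ 2).
    transitivity ((p ^+ 2 + q ^+ 2) * (r ^+ 2 + s ^+ 2) - (p * r + q * s) ^+ 2); first by ring.
    by rewrite prqs; ring.
  have D0 : p * s - q * r != 0 by rewrite -sqrf_eq0 D2 mulf_neq0// lt0r_neq0.
  have rE : (p ^+ 2 + q ^+ 2) * r = - q * (p * s - q * r).
    transitivity (p * (p * r + q * s) - q * (p * s - q * r)); first by ring.
    by rewrite prqs; ring.
  have sE : (p ^+ 2 + q ^+ 2) * s = p * (p * s - q * r).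
    transitivity (q * (p * r + q * s) + p * (p * s - q * r)); first by ring.
    by rewrite prqs; ring.
  have f3 : - q * x + p * z = - b2 * q.
    apply: (mulfI D0).
    transitivity ((p ^+ 2 + q ^+ 2) * r * x + (p ^+ 2 + q ^+ 2) * s * z).
      by rewrite rE sE; ring.
    transitivity ((p ^+ 2 + q ^+ 2) * (r * x + s * z)); first by ring.
    by rewrite h3 mulrCA rE; ring.
  have f4 : - q * y + p * w = b2 * p.
    apply: (mulfI D0).
    transitivity ((p ^+ 2 + q ^+ 2) * r * y + (p ^+ 2 + q ^+ 2) * s * w).
      by rewrite rE sE; ring.
    transitivity ((p ^+ 2 + q ^+ 2) * (r * y + s * w)); first by ring.
    by rewrite h4 mulrCA sE; ring.
  apply: (mulfI (lt0r_neq0 m1)); apply/eqP; rewrite -subr_eq0; apply/eqP.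
  transitivity (q * (p * x + q * z) + p * (- q * x + p * z) - p * (p * y + q * w) +
                q * (- q * y + p * w)); first by ring.
  by rewrite h1 h2 f3 f4; ring.
exact: (aux _ _ _ _ _ _ _ _ a12 n1 n2 e1 e1' e2 e2').
Qed.

End eigenvectors.

Section linear_forms_pairing.
Context {R : realType}.
Variables (B : 'M[R]_2) (b1 b2 : R).
Hypothesis b12 : b1 != b2.
Hypotheses (b1_lt0 : b1 < 0) (b2_lt0 : b2 < 0).
Hypothesis trB : B 0 0 + B 1 1 = b1 + b2.
Hypothesis detB : B 0 0 * B 1 1 - B 0 1 * B 1 0 = b1 * b2.
Variables a1 a2 : R * R.
Hypothesis a1B : (colv a1)^T *m B = b1 *: (colv a1)^T.
Hypothesis a2B : (colv a2)^T *m B = b2 *: (colv a2)^T.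
Notation goo := (gamma 1%:M B +oo%E).

(** Only the mixed term of [Qmx_spectral] survives, since each [a_i] is fixed by one
    of the spectral projections and annihilated by the other. *)
Lemma bform_Qmx_eigen : bform (Qmx 1%:M B +oo%E) a1 a2 = exp_int (b1 + b2) +oo%E * dotp a1 a2.
Proof.
have proj (a : R * R) (b c : R) : b != c -> (colv a)^T *m B = b *: (colv a)^T ->
    (colv a)^T *m specproj B b c = (colv a)^T /\ (colv a)^T *m specproj B c b = 0.
  move=> bc aB; rewrite /specproj -!scalemxAr !mulmxBr aB !mul_mx_scalar subrr scaler0.
  by rewrite -scalerBl scalerA mulVf ?scale1r// subr_eq0.
have [r1 r1'] := proj _ _ _ b12 a1B.
have b21 : b2 != b1 by rewrite eq_sym.
have [r2 r2'] := proj _ _ _ b21 a2B.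
rewrite /bform (Qmx_spectral b12 b1_lt0 b2_lt0 trB detB (ltry 0)).
have s2 : (specproj B b2 b1)^T *m colv a2 = colv a2.
  by rewrite -[LHS]trmxK trmx_mul trmxK r2 trmxK.
have s2' : (specproj B b1 b2)^T *m colv a2 = 0.
  by rewrite -[LHS]trmxK trmx_mul trmxK r2' trmx0.
move: (exp_int _ _) (exp_int _ _) (exp_int _ _) r1 r1' s2 s2' => c11 c12 c22.
move: (specproj _ _ _) (specproj _ _ _) => p1 p2 r1 r1' s2 s2'.
rewrite !mulmxDr !mulmxDl -!scalemxAr -!scalemxAl !mulmxDr !mulmxDl !mulmxA.
rewrite r1 r1' !mul0mx -!mulmxA s2 s2' !mulmx0 !(addr0,add0r,scaler0).
by rewrite mxE /dotp mul2E !mxE.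
Qed.

Lemma L2dot_lform : exists2 m : R, 0 < m &
  L2dot goo (fun x => (lform a1 x)%:C) (fun x => (lform a2 x)%:C) = (m * dotp a1 a2)%:C.
Proof.
have ooE : (0 < +oo :> \bar R)%E by rewrite ltry.
have [h1 h2 h3] := Qmx_posdef b12 b1_lt0 b2_lt0 trB detB ooE.
exists (ip goo (whit1 1%:M B +oo%E) (whit1 1%:M B +oo%E) * exp_int (b1 + b2) +oo%E).
  rewrite mulr_gt0 ?ip_whit11_gt0// exp_int_gt0//.
  by move: b1_lt0 b2_lt0; lra.
rewrite L2dotE; [|exact/(L2_real b12 b1_lt0 b2_lt0 trB detB)/Lfun2_lform..].
have z1 (f : R * R -> R) : ip goo (fun=> 0) f = 0.
  rewrite /ip; under eq_Rintegral do rewrite mul0r.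
  exact: (Rintegral_gamma_cst b12 b1_lt0 b2_lt0 trB detB ooE).
have z2 (f : R * R -> R) : ip goo f (fun=> 0) = 0 by rewrite ipC z1.
apply: eq_complexP; rewrite [LHS]/= [RHS]/= !(z1,z2) ?subr0 ?addr0//.
rewrite (ip_lform h1 h2 h3) -[RHS]mulrA -bform_Qmx_eigen; congr (_ * _).
have expand (S : 'M[R]_2) : S 1 0 = S 0 1 -> a1.1 * a2.1 * S 0 0 +
    (a1.1 * a2.2 + a1.2 * a2.1) * S 0 1 + a1.2 * a2.2 * S 1 1 = bform S a1 a2.
  by move=> S10; rewrite /bform !mul2E S10 !mxE /=; ring.
exact: expand.
Qed.

End linear_forms_pairing.

Theorem proposition5p2 (R : realType) (B : 'M[R]_2) (b1 b2 : R)
  (hb12 : b1 != b2) (hb1 : b1 < 0) (hb2 : b2 < 0)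
  (eb1 : eigenvalue B b1) (eb2 : eigenvalue B b2) :
  (forall (mu nu : R[i]), mu != nu ->
     forall u v : R * R -> R[i],
       gen_eigenspace 1%:M B mu u -> gen_eigenspace 1%:M B nu v ->
       L2dot (gamma 1%:M B +oo%E) u v = 0)
  <-> orthogonal_eigenspaces B b1 b2.
Proof.
have [trB detB] := eigenvalues2_trdet hb12 eb1 eb2.
have left_eigenvector b : eigenvalue B b ->
    exists2 a : R * R, a != 0 & (colv a)^T *m B = b *: (colv a)^T.
  case/eigenvalueP => w wB w0; exists (w 0 0, w 0 1).
    apply: contra w0 => /eqP[w00 w01]; apply/eqP/rowP.
    by apply: ord2P; rewrite mxE.
  suff -> : (colv (w 0 0, w 0 1))^T = w by [].
  by apply/rowP; apply: ord2P; rewrite !mxE.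
have [a1 a1_neq0 a1B] := left_eigenvector _ eb1.
have [a2 a2_neq0 a2B] := left_eigenvector _ eb2.
rewrite (orthogonal_eigenspacesP hb12 trB a1_neq0 a2_neq0 a1B a2B).
split=> [orth|a12]; last first.
  apply: (symmetric_gen_eigenspaces_orthogonal hb12 hb1 hb2 trB detB).
  exact: (orthogonal_symmetric a1_neq0 a2_neq0 a1B a2B).
have [m m0 pair] := L2dot_lform hb12 hb1 hb2 trB detB a1B a2B.
apply/eqP/negPn/negP => a12.
have L (a : R * R) : L2 (gamma 1%:M B +oo%E) (fun x => (lform a x)%:C).
  apply: (L2_real hb12 hb1 hb2 trB detB).
  have [h1 h2 h3] := Qmx_posdef hb12 hb1 hb2 trB detB (ltry 0).
  exact: Lfun2_lform.
have pair0 : L2dot (gamma 1%:M B +oo%E)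
    (fun x => (lform a1 x)%:C) (fun x => (lform a2 x)%:C) != 0.
  by rewrite pair fmorph_eq0 mulf_neq0// gt_eqF.
have n1 : ~ L2eq (gamma 1%:M B +oo%E) (fun x => (lform a1 x)%:C) (fun=> 0).
  by move=> /(L2dot_ae0 (L a1) (L a2)) e; move: pair0; rewrite e eqxx.
have n2 : ~ L2eq (gamma 1%:M B +oo%E) (fun x => (lform a2 x)%:C) (fun=> 0).
  move=> /(L2dot_ae0 (L a2) (L a1)) e; move: pair0.
  by rewrite (L2dotC (L a2) (L a1)) e rmorph0 eqxx.
have b12C : b1%:C != b2%:C :> R[i] by rewrite (inj_eq (fmorph_inj _)).
have hb21 : b2 != b1 by rewrite eq_sym.
have trB' : B 0 0 + B 1 1 = b2 + b1 by rewrite trB addrC.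
have detB' : B 0 0 * B 1 1 - B 0 1 * B 1 0 = b2 * b1 by rewrite detB mulrC.
move/eqP: pair0; apply; apply: (orth _ _ b12C).
  exact: (gen_eigenspace_lform hb12 hb1 hb2 trB detB a1B n1).
exact: (gen_eigenspace_lform hb21 hb2 hb1 trB' detB' a2B n2).
Qed.
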